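(* Let $K$ be a number field and $k\ge2$ an integer. The extended symmetry group of the topological dynamical system $\mathbb D_{K,k}=(\mathbb X_{K,k},\mathcal O_K)$ consists exactly of the pairs $(f,A)$, where $A:\mathcal O_K\to\mathcal O_K$ is of the form $A=M_\varepsilon\circ\tau$ with $\tau\in\operatorname{Aut}(K)$ and $\varepsilon\in\mathcal O_K^\times$ (where $M_\varepsilon(x)=\varepsilon x$), and where $f:\mathbb X_{K,k}\to\mathbb X_{K,k}$ is defined by $f(S)=t+\varepsilon\cdot\tau(S)$ for some $t\in\mathcal O_K$. In particular, the extended symmetry group is isomorphic to $\mathcal O_K\rtimes(\mathcal O_K^\times\rtimes\operatorname{Aut}(K))$ (with the natural actions).
   Context: $\mathcal O_K$ is the ring of integers of $K$ and $\operatorname{Aut}(K)$ its group of field automorphisms. The power set $\mathcal P(\mathcal O_K)\cong\{0,1\}^{\mathcal O_K}$ carries the product topology and the translation action of the additive group $\mathcal O_K$. $\mathbb X_{K,k}\subseteq\mathcal P(\mathcal O_K)$ is the closed translation-invariant set of admissible subsets: subsets $S\subseteq\mathcal O_K$ such that for every (nonzero) prime ideal $\mathfrak p$ of $\mathcal O_K$, $S$ is disjoint from at least one residue class modulo $\mathfrak p^k$. (Equivalently, for $k\ge 2$, it is the closure of the $\mathcal O_K$-orbit of the set $V_{K,k}$ of $x\in\mathcal O_K$ not lying in $\mathfrak p^k$ for any $\mathfrak p$.) $\mathbb D_{K,k}$ denotes $\mathbb X_{K,k}$ with the translation action of $\mathcal O_K$. A topological dynamical system $(\mathbb X,G)$ is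 a compact space $\mathbb X$ with an action of a group $G$ by homeomorphisms (written additively). Its extended symmetry group is the group of pairs $(f,A)$ where $A:G\to G$ is a group automorphism and $f:\mathbb X\to\mathbb X$ is a homeomorphism with $f(g+X)=A(g)+f(X)$ for all $g\in G$, $X\in\mathbb X$, with componentwise composition. *)

(* Defs.v *)
From HB Require Import structures.
From mathcomp Require Import all_boot all_order all_algebra all_field.
From mathcomp Require Import all_classical topology.

Set Implicit Arguments.
Unset Strict Implicit.
Unset Printing Implicit Defensive.

Import GRing.Theory.

Local Open Scope classical_set_scope.
Local Open Scope ring_scope.

Record bijection (T : Type) := Bijection {
  bij_fun :> T -> T;
  bij_funP : bijective bij_fun }.

HB.instance Definition _ (T : Type) := gen_eqMixin (bijection T).
HB.instance Definition _ (T : Type) := gen_choiceMixin (bijection T).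

Section BijectionGroup.
Variable T : Type.
Implicit Types s t : bijection T.

Lemma bijectionP s t : s =1 t -> s = t.
Proof.
case: s t => [f fP] [g gP] /= /funext fg; subst g.
by congr Bijection; exact: Prop_irrelevance.
Qed.

Lemma bijection_inv_ex s : exists g : T -> T, cancel s g /\ cancel g s.
Proof. by case: (bij_funP s) => g sK gK; exists g. Qed.

Definition bijection_invf s : T -> T := projT1 (cid (bijection_inv_ex s)).

Lemma bijection_invfK s : cancel s (bijection_invf s).
Proof. by case: (projT2 (cid (bijection_inv_ex s))). Qed.

Lemma bijection_invfVK s : cancel (bijection_invf s) s.
Proof. by case: (projT2 (cid (bijection_inv_ex s))). Qed.

Definition bijection_one : bijection T :=
  @Bijection T id (Bijective (fun=> erefl) (fun=> erefl)).

Definition bijection_mul s t : bijection T :=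
  @Bijection T (s \o t) (bij_comp (bij_funP s) (bij_funP t)).

Definition bijection_inv s : bijection T :=
  Bijection (Bijective (@bijection_invfVK s) (@bijection_invfK s)).

Lemma bijection_mulA : associative bijection_mul.
Proof. by move=> s t u; exact: bijectionP. Qed.
Lemma bijection_mul1 : left_id bijection_one bijection_mul.
Proof. by move=> s; exact: bijectionP. Qed.
Lemma bijection_mulr1 : right_id bijection_one bijection_mul.
Proof. by move=> s; exact: bijectionP. Qed.
Lemma bijection_mulV : left_inverse bijection_one bijection_inv bijection_mul.
Proof. by move=> s; apply: bijectionP => x /=; rewrite bijection_invfK. Qed.
Lemma bijection_mulrV : right_inverse bijection_one bijection_inv bijection_mul.
Proof. by move=> s; apply: bijectionP => x /=; rewrite bijection_invfVK. Qed.

HB.instance Definition _ := isGroup.Build (bijection T)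
  bijection_mulA bijection_mul1 bijection_mulr1 bijection_mulV bijection_mulrV.

Lemma bijV_fun s (g : T -> T) : cancel s g -> s^-1%g =1 g.
Proof. by move=> sK x; rewrite -[in RHS](bijection_invfVK s x) sK. Qed.
End BijectionGroup.

Lemma zmod_morphism_inv (U V : zmodType) (f : U -> V) (g : V -> U) :
  zmod_morphism f -> cancel f g -> cancel g f -> zmod_morphism g.
Proof. by move=> fB fK gK x y; apply: (can_inj fK); rewrite fB !gK. Qed.

Section RingAutomorphisms.
Variable R : nzRingType.

Definition is_ring_aut : {pred bijection R} :=
  fun s => `[< zmod_morphism s /\ monoid_morphism s >].

Record ring_aut := RingAut {
  ring_aut_bij :> bijection R;
  ring_autP : ring_aut_bij \in is_ring_aut }.

HB.instance Definition _ := [isSub for ring_aut_bij].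
HB.instance Definition _ := [Choice of ring_aut by <:].

Lemma is_ring_aut_group_closed : group_closed is_ring_aut.
Proof.
split; first by apply/asboolP; split.
move=> s t /asboolP[sB [s1 sM]] /asboolP[tB [t1 tM]]; apply/asboolP.
have tK : cancel t (bijection_invf t) := @bijection_invfK _ t.
have tVK : cancel (bijection_invf t) t := @bijection_invfVK _ t.
split; last split.
- by move=> x y /=; rewrite (zmod_morphism_inv tB tK tVK) sB.
- by rewrite /=; have := tK 1; rewrite t1 => ->.
- by move=> x y /=; rewrite -sM; congr (s _); apply: (can_inj tK); rewrite tM !tVK.
Qed.

HB.instance Definition _ :=
  SubChoice_isSubGroup.Build _ _ ring_aut is_ring_aut_group_closed.

Lemma ring_aut_zmod_morphism (s : ring_aut) : zmod_morphism s.
Proof. by have /asboolP[] := ring_autP s. Qed.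
Lemma ring_aut_monoid_morphism (s : ring_aut) : monoid_morphism s.
Proof. by have /asboolP[] := ring_autP s. Qed.

HB.instance Definition _ (s : ring_aut) :=
  GRing.isZmodMorphism.Build R R s (ring_aut_zmod_morphism s).
HB.instance Definition _ (s : ring_aut) :=
  GRing.isMonoidMorphism.Build R R s (ring_aut_monoid_morphism s).
End RingAutomorphisms.

Section UnitGroup.
Variable R : unitRingType.

Record runit := RUnit { runit_val :> R; runitP : runit_val \is a GRing.unit }.

HB.instance Definition _ := [isSub for runit_val].
HB.instance Definition _ := [Choice of runit by <:].

Definition runit_one := RUnit (unitr1 R).
Definition runit_mul (u v : runit) :=
  @RUnit (runit_val u * runit_val v) (etrans (unitrMl u (runitP v)) (runitP u)).
Definition runit_inv (u : runit) :=
  @RUnit (runit_val u)^-1 (etrans (unitrV u) (runitP u)).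

Lemma runit_mulA : associative runit_mul.
Proof. by move=> u v w; apply: val_inj; rewrite /= mulrA. Qed.
Lemma runit_mul1 : left_id runit_one runit_mul.
Proof. by move=> u; apply: val_inj; rewrite /= mul1r. Qed.
Lemma runit_mulr1 : right_id runit_one runit_mul.
Proof. by move=> u; apply: val_inj; rewrite /= mulr1. Qed.
Lemma runit_mulV : left_inverse runit_one runit_inv runit_mul.
Proof. by move=> u; apply: val_inj; rewrite /= mulVr ?runitP. Qed.
Lemma runit_mulrV : right_inverse runit_one runit_inv runit_mul.
Proof. by move=> u; apply: val_inj; rewrite /= mulrV ?runitP. Qed.

HB.instance Definition _ := isGroup.Build runit
  runit_mulA runit_mul1 runit_mulr1 runit_mulV runit_mulrV.
End UnitGroup.

Section SemidirectProduct.
Local Open Scope group_scope.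

Record aut_action (H N : groupType) := AutAction {
  aut_act :> H -> N -> N;
  aut_act1 : forall n, aut_act 1 n = n;
  aut_actM : forall g h n, aut_act (g * h) n = aut_act g (aut_act h n);
  aut_act_morph : forall h, {morph aut_act h : x y / x * y} }.

Variables (H N : groupType) (a : aut_action H N).

Definition sdprod (a0 : aut_action H N) : Type := (N * H)%type.

HB.instance Definition _ := Choice.copy (sdprod a) (N * H)%type.

Implicit Types x y z : sdprod a.

Definition sdprod_one : sdprod a := (1, 1).
(* Pairs (n, h) with (n, h)(n', h') = (n (h . n'), h h'), i.e. N ><| H. *)
Definition sdprod_mul x y : sdprod a := (x.1 * a x.2 y.1, x.2 * y.2).
Definition sdprod_inv x : sdprod a := (a x.2^-1 x.1^-1, x.2^-1).

Lemma aut_act_1 h : a h 1 = 1.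
Proof. by apply: (mulgI (a h 1)); rewrite -aut_act_morph !mulg1. Qed.

Lemma sdprod_mulA : associative sdprod_mul.
Proof.
by move=> x y z; rewrite /sdprod_mul /= aut_act_morph aut_actM !mulgA.
Qed.
Lemma sdprod_mul1 : left_id sdprod_one sdprod_mul.
Proof. by case=> n h; rewrite /sdprod_mul /= aut_act1 !mul1g. Qed.
Lemma sdprod_mulr1 : right_id sdprod_one sdprod_mul.
Proof. by case=> n h; rewrite /sdprod_mul /= aut_act_1 !mulg1. Qed.
Lemma sdprod_mulV : left_inverse sdprod_one sdprod_inv sdprod_mul.
Proof.
by case=> n h; rewrite /sdprod_mul /= -aut_act_morph !mulVg aut_act_1.
Qed.
Lemma sdprod_mulrV : right_inverse sdprod_one sdprod_inv sdprod_mul.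
Proof.
by case=> n h; rewrite /sdprod_mul /= -aut_actM !mulgV aut_act1 mulgV.
Qed.

HB.instance Definition _ := isGroup.Build (sdprod a)
  sdprod_mulA sdprod_mul1 sdprod_mulr1 sdprod_mulV sdprod_mulrV.
End SemidirectProduct.

Definition isomorphic_groups (G H : groupType) : Prop :=
  exists2 phi : G -> H, bijective phi & {morph phi : x y / (x * y)%g}.

Record dynamical_system (G : zmodType) := DynamicalSystem {
  ds_space :> topologicalType;
  ds_act : G -> ds_space -> ds_space;
  ds_compact : compact [set: ds_space];
  ds_act0 : forall x, ds_act 0 x = x;
  ds_actD : forall g h x, ds_act (g + h) x = ds_act g (ds_act h x);
  ds_act_continuous : forall g, continuous (ds_act g) }.

Definition homeomorphism (X Y : topologicalType) (f : X -> Y) : Prop :=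
  exists g : Y -> X, [/\ cancel f g, cancel g f, continuous f & continuous g].

Definition group_automorphism (G : zmodType) (A : G -> G) : Prop :=
  zmod_morphism A /\ bijective A.

Definition extended_symmetry (G : zmodType) (X : dynamical_system G)
    (f : X -> X) (A : G -> G) : Prop :=
  [/\ group_automorphism A, homeomorphism f &
      forall g x, f (ds_act g x) = ds_act (A g) (f x)].

Section ExtendedSymmetryGroup.
Variables (G : zmodType) (X : dynamical_system G).

Definition is_ext_sym : {pred bijection X * bijection G} :=
  fun p => `[< @extended_symmetry G X p.1 p.2 >].

Record ext_sym := ExtSym {
  ext_sym_pair :> bijection X * bijection G;
  ext_symP : ext_sym_pair \in is_ext_sym }.

HB.instance Definition _ := [isSub for ext_sym_pair].
HB.instance Definition _ := [Choice of ext_sym by <:].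

Lemma is_ext_sym_group_closed : group_closed is_ext_sym.
Proof.
split.
  apply/asboolP; split => //=.
    by split=> //; exact: (bij_funP (1%g : bijection G)).
  by exists id; split => // x; exact: cvg_id.
move=> p q /asboolP[[p2B _] [pV [pK pVK pc pVc]] pA].
move=> /asboolP[[q2B _] [qV [qK qVK qc qVc]] qA]; apply/asboolP.
have q2K := @bijection_invfK _ q.2; have q2VK := @bijection_invfVK _ q.2.
have q1V : bijection_invf q.1 = qV by apply/funext; exact: (bijV_fun qK).
split=> /=.
- split; last exact: (bij_funP (p.2 * q.2^-1)%g).
  by move=> x y /=; rewrite (zmod_morphism_inv q2B q2K q2VK) p2B.
- exists (q.1 \o pV); rewrite q1V; split.
  + by move=> x /=; rewrite pK qVK.
  + by move=> x /=; rewrite qK pVK.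
  + by move=> x; apply: continuous_comp; [exact: qVc|exact: pc].
  + by move=> x; apply: continuous_comp; [exact: pVc|exact: qc].
- move=> g x; rewrite -pA; congr (p.1 _); rewrite q1V.
  by apply: (can_inj qK); rewrite qA !qVK q2VK.
Qed.

HB.instance Definition _ :=
  SubChoice_isSubGroup.Build _ _ ext_sym is_ext_sym_group_closed.
End ExtendedSymmetryGroup.

Section RingOfIntegers.
Variable K : fieldExtType rat.

Definition integer : {pred K} :=
  fun x => `[< integralOver (intr : int -> K) x >].

Lemma integer_subring : subring_closed integer.
Proof.
split=> [|x y /asboolP xi /asboolP yi|x y /asboolP xi /asboolP yi];
  apply/asboolP.
- exact: integral1.
- exact: integral_sub.
- exact: integral_mul.
Qed.

HB.instance Definition _ := GRing.isSubringClosed.Build K integer integer_subring.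

Record ring_of_integers := RingOfIntegers {
  oval :> K;
  ovalP : oval \in integer }.

Local Notation OK := ring_of_integers.

HB.instance Definition _ := [isSub for oval].
HB.instance Definition _ := [Choice of OK by <:].
HB.instance Definition _ := [SubChoice_isSubComNzRing of OK by <:].

Lemma oval_zmod_morphism : zmod_morphism oval. Proof. by []. Qed.
Lemma oval_monoid_morphism : monoid_morphism oval. Proof. by []. Qed.
HB.instance Definition _ :=
  GRing.isZmodMorphism.Build OK K oval oval_zmod_morphism.
HB.instance Definition _ :=
  GRing.isMonoidMorphism.Build OK K oval oval_monoid_morphism.

Definition ounit : pred OK := fun x => (x != 0) && ((oval x)^-1 \in integer).
Definition oinv (x : OK) : OK := insubd x (oval x)^-1.

Lemma oinvE x : ounit x -> oval (oinv x) = (oval x)^-1.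
Proof. by case/andP=> _ xi; rewrite /oinv insubdK. Qed.

Lemma omulVr : {in ounit, left_inverse 1 oinv *%R}.
Proof.
move=> x xu; apply: val_inj; rewrite /= oinvE // mulVf //.
by case/andP: xu => + _; apply: contra => /eqP x0; apply/eqP/val_inj.
Qed.

Lemma ounitP (x y : OK) : y * x = 1 -> ounit x.
Proof.
move=> yx1; have yx : oval y * oval x = 1 by rewrite -[LHS]/(oval (y * x)) yx1.
have x0 : oval x != 0 by apply: contra_eq_neq yx => ->; rewrite mulr0 eq_sym oner_eq0.
apply/andP; split; first by apply: contra x0 => /eqP ->.
by rewrite -[_^-1]mul1r -yx mulfK //; exact: ovalP.
Qed.

Lemma oinv_out : {in [predC ounit], oinv =1 id}.
Proof.
move=> x; rewrite !inE negb_and negbK => /orP[/eqP ->|xi].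
  by apply: val_inj; rewrite /oinv val_insubd /= invr0 if_same.
by apply: val_inj; rewrite /oinv val_insubd (negPf xi).
Qed.

HB.instance Definition _ :=
  GRing.ComNzRing_hasMulInverse.Build OK omulVr ounitP oinv_out.
HB.instance Definition _ := [SubComUnitRing_isSubIntegralDomain of OK by <:].

Lemma ring_aut_integer (tau : ring_aut K) (x : OK) : tau (oval x) \in integer.
Proof.
apply/asboolP; have /asboolP/(integral_rmorph tau) := ovalP x.
case=> p pm pr; exists p => //; congr root : pr.
by apply: eq_map_poly => n /=; rewrite rmorph_int.
Qed.

Definition oaut (tau : ring_aut K) (x : OK) : OK :=
  RingOfIntegers (ring_aut_integer tau x).

End RingOfIntegers.

Lemma common_denominator (I : finType) (f : I -> rat) :
  exists2 c : int, c != 0 & forall i, exists z : int, c%:~R * f i = z%:~R.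
Proof.
exists (\prod_i denq (f i)).
  by apply/prodf_neq0 => i _; exact: denq_neq0.
move=> i; rewrite (bigD1 i) //=.
exists (numq (f i) * \prod_(j | j != i) denq (f j)).
by rewrite !intrM mulrAC mulrC [_ * f i]mulrC -numqE mulrC.
Qed.

Section FiniteQuotients.
Variable K : fieldExtType rat.
Local Notation OK := (ring_of_integers K).

Lemma congruent_pair (n : int) : n != 0 ->
  exists m, forall x : 'I_m -> K, exists i j, i != j /\
    exists w : 'I_m -> int, x i - x j = n%:~R * \sum_l (w l)%:~R * x l.
Proof.
move=> n0; set d := \dim {:K}.
have [N DN] : exists N, `|n|%N = N.+1.
  by exists `|n|.-1%N; rewrite prednK // absz_gt0.
pose m := (N.+1 ^ d + d).+1; exists m => x.
have dm : (d <= m)%N by rewrite /m -addSn leq_addl.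
pose b := vbasis {:K}.
pose F (u : 'I_m * 'I_d) : rat := coord b u.2 (x u.1).
have [c c0 cF] := common_denominator F.
pose A : 'M[int]_(m, d) := \matrix_(i, j) projT1 (cid (cF (i, j))).
have AE i j : (A i j)%:~R = c%:~R * coord b j (x i).
  by rewrite mxE; case: (cid _) => z /= <-.
have [L Lu [R _ [s _ AD]]] := int_Smith_normal_form A.
set D := \matrix_(i, j) _ in AD; pose B := D *m R.
have AB : A = L *m B by rewrite AD mulmxA.
have BA : B = invmx L *m A by rewrite AB mulKmx.
have B0 (l : 'I_m) j : (d <= l)%N -> B l j = 0.
  move=> dl; rewrite mxE big1 // => l' _; rewrite mxE.
  by rewrite gtn_eqF ?mulr0n ?mul0r // (leq_trans (ltn_ord l') dl).
have modlt z : (`|(z %% n)%Z| < N.+1)%N.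
  by rewrite -ltz_nat gez0_abs ?modz_ge0 // -DN abszE ltz_mod.
pose f (i : 'I_m) : {ffun 'I_d -> 'I_N.+1} :=
  [ffun j => Ordinal (modlt (L i (widen_ord dm j)))].
have /injectivePn[i [j ij fij]] : ~~ injectiveb f.
  apply/negP => /injectiveP /leq_card.
  by rewrite card_ffun !card_ord /m leqNgt ltnS leq_addr.
exists i, j; split=> //.
pose q := \row_(l < m) (if (l < d)%N then ((L i l - L j l) %/ n)%Z else 0).
pose w := q *m invmx L; exists (fun l => w 0 l).
have qE (l : 'I_m) : (l < d)%N -> L i l - L j l = n * q 0 l.
  move=> ld; rewrite mxE ld mulrC divzK //.
  move/ffunP/(_ (Ordinal ld)): fij; rewrite !ffunE => /(congr1 val) /=.
  rewrite (_ : widen_ord dm _ = l); last exact: val_inj.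
  move=> /(congr1 Posz); rewrite !gez0_abs ?modz_ge0 // => e.
  by rewrite -eqz_mod_dvd; apply/eqP.
have key l : A i l - A j l = n * \sum_l' w 0 l' * A l' l.
  have -> : \sum_l' w 0 l' * A l' l = (q *m B) 0 l.
    by rewrite BA mulmxA -/w mxE.
  rewrite AB !mxE -sumrB mulr_sumr; apply: eq_bigr => l' _.
  rewrite -mulrBl mulrA; have [ld|dl] := ltnP l' d; first by rewrite qE.
  by rewrite B0 // !mulr0.
have cK : (c%:~R : rat) != 0 by rewrite intr_eq0.
have coordP u v : (forall l, coord b l u = coord b l v) -> u = v.
  move=> uv; rewrite (coord_vbasis (memvf u)) (coord_vbasis (memvf v)).
  by apply: eq_bigr => l _; rewrite uv.
apply: coordP => l; apply: (mulfI cK).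
rewrite mulrzl linearB raddfMz raddf_sum mulrBr -!AE -rmorphB key /=.
rewrite intrM mulrzl rmorph_sum /= mulrzAr mulr_sumr; congr (_ *~ n).
apply: eq_bigr => l' _.
by rewrite mulrzl raddfMz mulrzAr -AE intrM mulrzl.
Qed.
Lemma finite_residues (n : int) : n != 0 ->
  exists r : seq OK, forall a : OK,
    exists2 b, b \in r & exists c : OK, b - a = n%:~R * c.
Proof.
move=> n0; pose cong (x y : OK) := `[< exists c : OK, x - y = n%:~R * c >].
have [M MP] := congruent_pair n0.
pose P k := `[< exists2 s : seq OK, size s = k & pairwise (fun x y => ~~ cong x y) s >].
have P0 : exists k, P k by exists 0%N; apply/asboolP; exists [::].
have Pdown k s : (k <= size s)%N -> pairwise (fun x y => ~~ cong x y) s -> P k.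
  move=> ks sP; apply/asboolP; exists (take k s); first by rewrite size_takel.
  by apply: subseq_pairwise sP; rewrite take_subseq.
have PM k : P k -> (k <= M)%N.
  case/asboolP => s sk sP; rewrite leqNgt; apply/negP => Mk.
  have [i [j [ij [w wP]]]] := MP (fun i => oval (nth 0 s i)).
  have sz (l : 'I_M) : (l < size s)%N by rewrite sk (ltn_trans (ltn_ord l)).
  have c1 (u v : 'I_M) (w' : 'I_M -> int) :
      oval (nth 0 s u) - oval (nth 0 s v) =
      n%:~R * \sum_l (w' l)%:~R * oval (nth 0 s l) ->
      cong (nth 0 s u) (nth 0 s v).
    move=> e; apply/asboolP; exists (\sum_l (w' l)%:~R * nth 0 s l).
    apply: val_inj; rewrite rmorphB rmorphM rmorph_int rmorph_sum /= e.
    by congr (_ * _); apply: eq_bigr => l _; rewrite rmorph_int.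
  have /(pairwiseP 0) sP' := sP.
  case: (ltngtP i j) => [lt_ij|lt_ji|/val_inj e]; last by rewrite e eqxx in ij.
    by have := sP' i j (sz i) (sz j) lt_ij; rewrite (c1 _ _ _ wP).
  have := sP' j i (sz j) (sz i) lt_ji; rewrite (c1 _ _ (fun l => - w l)) //.
  rewrite -opprB wP -mulrN -sumrN; congr (_ * _).
  by apply: eq_bigr => l _; rewrite rmorphN mulNr.
case: (ex_maxnP P0 PM) => k /asboolP[s sk sP] kmax; exists s => a.
apply: contrapT => /forall2NP nex.
have /kmax : P k.+1.
  apply: (Pdown _ (rcons s a)); first by rewrite size_rcons sk.
  rewrite pairwise_rcons sP andbT; apply/allP => b bs.
  by apply/negP => /asboolP ba; have [] := nex b.
by rewrite ltnn.
Qed.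
End FiniteQuotients.

Section IdealPowers.
Variable R : comNzRingType.

Definition ideal_mul (I J : set R) : set R :=
  [set z | exists2 s : seq (R * R), {in s, forall u, I u.1 /\ J u.2} &
                                    z = \sum_(u <- s) u.1 * u.2].

(* The zeroth power is the unit ideal, i.e. the whole ring. *)
Fixpoint ideal_exp (I : set R) (n : nat) : set R :=
  if n is m.+1 then ideal_mul I (ideal_exp I m) else setT.

Lemma ideal_expD I n x y : ideal_exp I n x -> ideal_exp I n y ->
  ideal_exp I n (x + y).
Proof.
case: n => [//|n] [s sI ->] [t tI ->]; exists (s ++ t); last by rewrite big_cat.
by move=> u; rewrite mem_cat => /orP[/sI|/tI].
Qed.

Lemma ideal_expX I n c x : I c -> ideal_exp I n (c ^+ n * x).
Proof.
move=> Ic; elim: n => [//|n IH].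
exists [:: (c, c ^+ n * x)]; last by rewrite big_seq1 /= exprS mulrA.
by move=> u; rewrite inE => /eqP ->.
Qed.
End IdealPowers.

Section AdmissibleSets.
Variable K : fieldExtType rat.
Local Notation OK := (ring_of_integers K).

(* Subsets of the ring of integers are boolean functions on it, so that the
   power set is {0,1}^OK with its product topology {ptws OK -> bool}; the
   direct image h(S) of a subset S is then again such a function. *)
Definition subset_image (h : OK -> OK) (S : {ptws OK -> bool}) :
    {ptws OK -> bool} :=
  fun y => `[< exists2 x, S x & h x = y >].

(* A prime_idealr is proper by definition but may be the zero ideal, which has
   to be excluded. The residue class of a modulo p^k is the set of the x with
   x - a in p^k. *)
Definition admissible (k : nat) : set {ptws OK -> bool} :=
  [set S | forall p : prime_idealr OK, (exists2 x, x \in p & x != 0) ->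
     exists a : OK, forall x, S x -> ~ ideal_exp [set` p] k (x - a)].

Lemma ideal_int_mem (p : prime_idealr OK) (x : OK) : x \in p -> x != 0 ->
  exists2 n : int, n != 0 & n%:~R \in p.
Proof.
move=> xp x0; have /asboolP[q qm qx] := ovalP x.
have {qx} : (map_poly intr q).[x] = 0 :> OK.
  apply: val_inj; rewrite /= -horner_map /= -map_poly_comp.
  by rewrite -[RHS](rootP qx); congr (_.[_]); apply: eq_map_poly => z /=;
     rewrite rmorph_int.
have {qm} : q != 0 by exact: monic_neq0.
elim/poly_ind: q => [|q c IH]; first by rewrite eqxx.
rewrite rmorphD rmorphM /= map_polyX map_polyC hornerMXaddC => q0 qx.
have [c0|c0] := eqVneq c 0; last first.
  exists c => //; rewrite (_ : c%:~R = - (map_poly intr q).[x] * x).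
    exact: idealMr.
  by apply/eqP; rewrite mulNr -addr_eq0 addrC qx.
apply: IH; first by apply: contra q0 => /eqP ->; rewrite c0 mul0r addr0.
by move/eqP: qx; rewrite c0 /= ?mulr0z addr0 mulf_eq0 (negPf x0) orbF => /eqP.
Qed.

Lemma closed_admissible k : closed (admissible k).
Proof.
pose F (p : OK -> bool) (a : OK) : set {ptws OK -> bool} :=
  \bigcap_(x in [set x | ideal_exp [set` p] k (x - a)]) [set S | S x = false].
rewrite (_ : admissible k = \bigcap_(P in [set P : OK -> bool |
    exists2 p : prime_idealr OK, exists2 x, x \in p & x != 0 & P = p])
    \bigcup_a F P a); last first.
  apply/seteqP; split=> [S SX _ [p pn0 ->]|S SX p pn0].
    have [a aP] := SX p pn0; exists a => // x /= xa.
    by apply/negbTE/negP => /aP.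
  have [|a _ aP] := SX p; first by exists p.
  by exists a => x Sx /aP; rewrite /= Sx.
apply: closed_bigI => _ [p [x xp x0] ->].
have [n n0 np] := ideal_int_mem xp x0.
have nk0 : n ^+ k != 0 by rewrite expf_neq0.
have [r rP] := finite_residues K nk0.
rewrite (_ : \bigcup_a F p a = \bigcup_(a in [set` r]) F p a).
  apply: closed_bigcup => [|a _]; first exact: finite_seq.
  apply: closed_bigI => y _.
  rewrite (_ : [set S | _] = (fun S : {ptws OK -> bool} => S y) @^-1` [set false]).
    apply: preimage_closed; last exact: discrete_closed.
    by move=> S _; exact: (@proj_continuous OK (fun=> bool) y).
  by [].
apply/seteqP; split=> [S [a _ aS]|S [a _ aS]]; last by exists a.
have [b br [c bc]] := rP a; exists b => // y /= yb; apply: aS => /=.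
rewrite (_ : y - a = (y - b) + (b - a)); last by rewrite addrA subrK.
by apply: ideal_expD yb _; rewrite bc rmorphXn; exact: ideal_expX.
Qed.

Lemma compact_admissible k : compact [set: set_type (admissible k)].
Proof.
have cA : compact (admissible k).
  apply: (@subclosed_compact _ _ setT); first exact: closed_admissible.
    have := @tychonoff OK (fun=> bool) (fun=> setT) (fun=> bool_compact).
    by rewrite (_ : [set f | _] = setT) //; apply/seteqP; split.
  by [].
move=> F FF _.
have PF : ProperFilter (set_val @ F).
  exact: (@fmap_proper_filter _ _ set_val F FF).
have FA : F (set_val @^-1` admissible k).
  rewrite (_ : _ @^-1` _ = setT); first exact: filterT.
  by apply/seteqP; split=> // x _; exact: set_mem (valP x).
have [S [SX Scl]] := cA _ PF FA.
exists (exist _ S (mem_set SX)); split=> // A B {}FA.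
case=> U [[V oV <-] VS VB].
have FA' : (set_val @ F) (set_val @` A).
  by apply: (@filterS _ F _ A) FA => x Ax; exists x.
have [_ [[x xA <-] Vy]] := Scl _ _ FA' (open_nbhs_nbhs (conj oV VS)).
by exists x; split=> //; exact: VB.
Qed.
End AdmissibleSets.

Section AdmissibleSystem.
Variables (K : fieldExtType rat) (k : nat).
Local Notation OK := (ring_of_integers K).
Local Notation X := (set_type (@admissible K k)).

Lemma subset_image_can (h h' : OK -> OK) S y :
  cancel h h' -> cancel h' h -> subset_image h S y = S (h' y).
Proof.
move=> hK h'K; apply/asboolP/idP => [[x Sx <-]|Sy]; first by rewrite hK.
by exists (h' y).
Qed.

Lemma translateE (g : OK) S y : subset_image (+%R g) S y = S (y - g).
Proof.
rewrite (subset_image_can (h' := fun y => y - g)) // => x.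
- by rewrite addrC addKr.
- by rewrite addrC subrK.
Qed.

Lemma admissible_translate (g : OK) S :
  admissible k S -> admissible k (subset_image (+%R g) S).
Proof.
move=> SX p pn0; have [a aP] := SX p pn0; exists (g + a) => x.
by rewrite translateE => /aP; rewrite -addrA -opprD.
Qed.

Definition translate (g : OK) (S : X) : X :=
  exist (fun S => S \in admissible k) (subset_image (+%R g) (\val S))
    (mem_set (admissible_translate g (set_valP S))).

Lemma translate0 S : translate 0 S = S.
Proof.
by apply: val_inj; apply/funext => x; rewrite /= translateE subr0.
Qed.

Lemma translateD g h S : translate (g + h) S = translate g (translate h S).
Proof.
by apply: val_inj; apply/funext => x; rewrite /= !translateE opprD addrA.
Qed.

Lemma translate_continuous g : continuous (translate g).
Proof.
apply: continuous_comp_initial => S; apply/cvg_sup; first exact/fmap_filter/nbhs_filter.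
move=> y; move: S.
apply/(@continuousP _ (initial_topology (@^~ y))) => A [B oB <-].
rewrite (_ : _ @^-1` _ = (fun S : X => (set_val S : OK -> bool) (y - g)) @^-1` B).
  apply: open_comp oB => S _.
  apply: (@continuous_comp X {ptws OK -> bool} bool set_val (fun f => f (y - g))).
    exact: initial_continuous.
  exact: (@proj_continuous OK (fun=> bool) (y - g)).
by apply/funext => S; rewrite /= !set_valE /= translateE.
Qed.

Definition admissible_system : dynamical_system OK :=
  DynamicalSystem (@compact_admissible K k) translate0 translateD
    translate_continuous.
End AdmissibleSystem.

Section NaturalActions.
Variable K : fieldExtType rat.
Local Notation OK := (ring_of_integers K).

Lemma oaut_zmod_morphism (tau : ring_aut K) : zmod_morphism (oaut tau).
Proof. by move=> x y; apply: val_inj; rewrite /= rmorphB. Qed.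
Lemma oaut_monoid_morphism (tau : ring_aut K) : monoid_morphism (oaut tau).
Proof.
by split=> [|x y]; apply: val_inj; rewrite /= ?rmorph1 ?rmorphM.
Qed.
HB.instance Definition _ (tau : ring_aut K) :=
  GRing.isZmodMorphism.Build OK OK (oaut tau) (oaut_zmod_morphism tau).
HB.instance Definition _ (tau : ring_aut K) :=
  GRing.isMonoidMorphism.Build OK OK (oaut tau) (oaut_monoid_morphism tau).

Lemma oaut1 x : oaut (1%g : ring_aut K) x = x. Proof. exact: val_inj. Qed.
Lemma oautM (s t : ring_aut K) x : oaut (s * t)%g x = oaut s (oaut t x).
Proof. exact: val_inj. Qed.

Definition oaut_unit (tau : ring_aut K) (u : runit OK) : runit OK :=
  RUnit (rmorph_unit (oaut tau) (runitP u)).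

Lemma oaut_unit1 u : oaut_unit 1%g u = u.
Proof. by apply: val_inj; exact: oaut1. Qed.
Lemma oaut_unitM s t u : oaut_unit (s * t)%g u = oaut_unit s (oaut_unit t u).
Proof. by apply: val_inj; exact: oautM. Qed.
Lemma oaut_unit_morph s : {morph oaut_unit s : u v / (u * v)%g}.
Proof. by move=> u v; apply: val_inj; exact: rmorphM. Qed.

Definition unit_action : aut_action (ring_aut K) (runit OK) :=
  AutAction oaut_unit1 oaut_unitM oaut_unit_morph.

Definition semilinear (e : sdprod unit_action) (x : OK) : OK :=
  runit_val e.1 * oaut e.2 x.

Lemma semilinear1 x : semilinear 1%g x = x.
Proof. by rewrite /semilinear /= mul1r oaut1. Qed.
Lemma semilinearM e e' x :
  semilinear (e * e')%g x = semilinear e (semilinear e' x).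
Proof. by rewrite /semilinear /= oautM rmorphM mulrA. Qed.
Lemma semilinear_morph e :
  {morph (semilinear e : Algebra.to_multiplicative OK -> Algebra.to_multiplicative OK) :
     x y / (x * y)%g}.
Proof. by move=> x y; rewrite /semilinear [LHS]/= (rmorphD (oaut e.2)) mulrDr. Qed.

(* (eps, tau) acts on the additive group of OK, seen as a multiplicative group
   through to_multiplicative, by x |-> eps * tau x. *)
Definition semilinear_action :
    aut_action (sdprod unit_action) (Algebra.to_multiplicative OK) :=
  @AutAction (sdprod unit_action) (Algebra.to_multiplicative OK) semilinear
    semilinear1 semilinearM semilinear_morph.
End NaturalActions.

(* Main.v *)
From HB Require Import structures.
Require Import Defs.
From mathcomp Require Import all_boot all_order all_algebra all_field.
From mathcomp Require Import all_classical topology.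
From mathcomp Require Import ring zify.

(** Call a prime p over the rational prime l good if O = Z + p^k; infinitely
    many l have a good prime (simple roots modulo l of the minimal polynomial of
    an integral primitive element), and then O / p^k has l^k classes, the least
    number possible for a prime over l.

    Let (f, A) be an extended symmetry. The empty set is the only fixed point of
    all translations, so f fixes it, and after a translation f({0}) contains 0.
    Suppose that y lies in f(S) but not in A(S), for a finite S. Pick a good p
    that separates y from A(S), and add to S a finite set S' of widely spread
    points such that A(S') meets every class modulo p^k except that of y; by the
    Chinese remainder theorem S and S' together can be kept admissible. By
    continuity f(S u S') contains y and A(S'), hence meets all classes modulo
    p^k, which is absurd. Thus f(S) is contained in A(S); the same for f^-1 gives
    equality, and then f = A on all admissible sets by density of finite ones.

    Now A preserves admissibility. Let p be good over a large l and x in p^k. The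
    set {c x, 1, ..., l^k - 1} meets all classes modulo p^k, so its image under A
    meets all classes modulo r_c^k for some prime r_c, which must lie over l (the
    primes not over l are neutralised by a Chinese remainder factor). There are
    fewer than l primes over l, so two values of c share the same r, whence A(x)
    lies in r^k. Applied to x - a and x^2 - a^2 with a an integer congruent to x,
    this gives A(x)^2 = A(1) A(x^2) modulo r^k, for infinitely many r. Hence
    A(x) A(y) = A(1) A(x y), and A / A(1) extends to an automorphism of K. *)

Set Implicit Arguments.
Unset Strict Implicit.
Unset Printing Implicit Defensive.

Import Order.TTheory GRing.Theory Num.Theory.
Local Open Scope classical_set_scope.
Local Open Scope ring_scope.

(** * Powers of ideals *)

Local Notation idl_exp p n := (ideal_exp [set` p] n).

Section IdealExp.
Variables (R : comNzRingType) (p : idealr R).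
Implicit Types (x y c : R) (n : nat).

Lemma ideal_expMl n c x : idl_exp p n x -> idl_exp p n (c * x).
Proof.
case: n => [//|n] [s sp ->]; exists [seq (c * u.1, u.2) | u <- s].
  by move=> _ /mapP[u /sp[up un] ->]; split=> //=; exact: idealMr.
by rewrite big_map mulr_sumr; apply: eq_bigr => u _; rewrite mulrA.
Qed.

Lemma ideal_exp0 n : idl_exp p n 0.
Proof. by case: n => [//|n]; exists [::]; rewrite ?big_nil. Qed.

Lemma ideal_expN n x : idl_exp p n x -> idl_exp p n (- x).
Proof. by rewrite -mulN1r; exact: ideal_expMl. Qed.

Lemma ideal_expB n x y : idl_exp p n x -> idl_exp p n y -> idl_exp p n (x - y).
Proof. by move=> xp /ideal_expN; exact: ideal_expD. Qed.

Lemma ideal_exp_subC n x y : idl_exp p n (x - y) -> idl_exp p n (y - x).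
Proof. by move/ideal_expN; rewrite opprB. Qed.

Lemma ideal_exp_trans n y x z :
  idl_exp p n (x - y) -> idl_exp p n (y - z) -> idl_exp p n (x - z).
Proof. by move=> xy yz; have := ideal_expD xy yz; rewrite addrA subrK. Qed.

Lemma ideal_exp_sum n (I : Type) (s : seq I) (P : pred I) (F : I -> R) :
  (forall i, P i -> idl_exp p n (F i)) -> idl_exp p n (\sum_(i <- s | P i) F i).
Proof.
move=> Fp; elim/big_rec: _ => [|i x Pi xp]; first exact: ideal_exp0.
by apply: ideal_expD xp; exact: Fp.
Qed.

Lemma ideal_exp_sum_seq n (I : eqType) (s : seq I) (F : I -> R) :
  (forall i, i \in s -> idl_exp p n (F i)) -> idl_exp p n (\sum_(i <- s) F i).
Proof. by move=> Fp; rewrite big_seq; exact: ideal_exp_sum. Qed.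

Lemma ideal_expSM n c x : c \in p -> idl_exp p n x -> idl_exp p n.+1 (c * x).
Proof.
move=> cp xp; exists [:: (c, x)]; last by rewrite big_seq1.
by move=> u; rewrite inE => /eqP ->.
Qed.

Lemma ideal_expS n x : idl_exp p n.+1 x -> idl_exp p n x.
Proof.
case=> s sp ->; apply: ideal_exp_sum_seq => u /sp[_ up].
exact: ideal_expMl.
Qed.

Lemma ideal_exp_le m n x : (m <= n)%N -> idl_exp p n x -> idl_exp p m x.
Proof.
elim: n => [|n IH]; first by rewrite leqn0 => /eqP ->.
by rewrite leq_eqVlt => /orP[/eqP -> //|mn] /ideal_expS; exact: IH.
Qed.

Lemma ideal_exp1 x : idl_exp p 1 x <-> x \in p.
Proof.
split=> [[s sp ->]|xp]; last by rewrite -[x]mulr1; exact: ideal_expSM.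
by rewrite big_seq rpred_sum // => u /sp[up _]; rewrite mulrC idealMr.
Qed.

Lemma ideal_exp_mem n x : (0 < n)%N -> idl_exp p n x -> x \in p.
Proof. by move=> n0 /(ideal_exp_le n0) /ideal_exp1. Qed.

Lemma ideal_exp_pow n c x : c \in p -> idl_exp p n (c ^+ n * x).
Proof. by move=> cp; apply: (@ideal_expX _ [set` p]). Qed.

End IdealExp.

Lemma ideal_exp_mono (R : comNzRingType) (p q : idealr R) n x :
  {subset p <= q} -> idl_exp p n x -> idl_exp q n x.
Proof.
move=> pq; elim: n x => [//|n IH] x [s sp ->].
by exists s => // u /sp[up un]; split; [exact: pq|exact: IH].
Qed.

Section PrimeAbove.
Variables (R : comNzRingType) (l : nat) (p : idealr R).
Hypotheses (l_pr : prime l) (lp : l%:R \in p).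

Lemma coprime_inv_mod (n : nat) (z : int) : ~~ (l %| `|z|)%N ->
  exists u v : int, u * z + v * (l ^ n)%:Z = 1.
Proof.
move=> lz; have /coprimezP[[u v] /= uv] : coprimez z (l ^ n)%:Z.
  by rewrite coprimezE absz_nat coprimeXr // coprime_sym prime_coprime.
by exists u, v.
Qed.

(** An integer prime to [l] is invertible modulo [l ^ n], and [l ^ n] lies in the [n]-th power of
    [p]. *)
Lemma ideal_exp_cancel n (z : int) x :
  ~~ (l %| `|z|)%N -> idl_exp p n (z%:~R * x) -> idl_exp p n x.
Proof.
move=> /(coprime_inv_mod n)[u [v uv]] zx.
rewrite -[x]mul1r -[1]/(1%:~R) -uv rmorphD !rmorphM /= mulrDl -mulrA.
apply: ideal_expD; first exact: ideal_expMl.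
rewrite -mulrA; apply: ideal_expMl.
by rewrite -pmulrn natrX; exact: ideal_exp_pow.
Qed.

Lemma int_in_ideal (z : int) : (z%:~R \in p) = (l %| `|z|)%N.
Proof.
apply/idP/idP => [zp|/dvdnP[m zE]]; last first.
  rewrite [z]intEsign zE PoszM !rmorphM /= idealMr //.
  by rewrite idealMr // -pmulrn.
apply: contraT => /(@ideal_exp_cancel 1 z 1); rewrite mulr1.
by move/(_ (proj2 (ideal_exp1 _ _) zp))/ideal_exp1; rewrite idealr1.
Qed.

End PrimeAbove.

(** * Residue classes modulo powers of a prime *)

Section Nakayama.
Variables (R : idomainType) (p : prime_idealr R).

(** Membership in the product of [p] with the ideal generated by [s], coded by one coefficient from
    [p] per generator so that generators can be removed one by one. *)
Fixpoint ideal_comb (s : seq R) (z : R) : Prop :=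
  if s is x :: s' then exists2 e, e \in p & ideal_comb s' (z - e * x)
  else z = 0.

Lemma ideal_comb0 s : ideal_comb s 0.
Proof.
elim: s => [//|x s IH] /=; exists 0; first exact: rpred0.
by rewrite mul0r subr0.
Qed.

Lemma ideal_combM s c z : ideal_comb s z -> ideal_comb s (c * z).
Proof.
elim: s z => [|x s IH] z /=; first by move=> ->; rewrite mulr0.
case=> e ep /IH ze; exists (c * e); first exact: idealMr.
by rewrite -mulrA -mulrBr.
Qed.

Lemma ideal_combD s y z : ideal_comb s y -> ideal_comb s z -> ideal_comb s (y + z).
Proof.
elim: s y z => [|x s IH] y z /=; first by move=> -> ->; rewrite addr0.
case=> e ep ye [f fp zf]; exists (e + f); first exact: rpredD.
by rewrite mulrDl opprD addrACA; exact: IH.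
Qed.

Lemma ideal_comb_mem s e x : x \in s -> e \in p -> ideal_comb s (e * x).
Proof.
move=> + ep; elim: s => [//|y s IH] /=; rewrite inE => /orP[/eqP ->|/IH xs].
  by exists e => //; rewrite subrr; exact: ideal_comb0.
by exists 0; [exact: rpred0|rewrite mul0r subr0].
Qed.

Lemma ideal_comb_zero s z : {in s, forall x, x = 0} -> ideal_comb s z -> z = 0.
Proof.
elim: s z => [//|x s IH] z /= s0 [e _]; rewrite (s0 x) ?mem_head // mulr0 subr0.
by apply: IH => y ys; apply: s0; rewrite inE ys orbT.
Qed.

(* Over a domain one generator can be eliminated at a time, which avoids the
   determinant trick. *)
Lemma nakayama s u : u \notin p -> {in s, forall x, ideal_comb s (u * x)} ->
  {in s, forall x, x = 0}.
Proof.
elim: s u => [//|x s IH] u up sp.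
have [e ep xe] := sp x (mem_head _ _).
have uep : u - e \notin p by rewrite rpredBr.
have s0 : {in s, forall y, y = 0}.
  (* [(u - e) * x] is a combination of the tail with coefficients in [p], so multiplying the
     relation for [y] by [u - e] eliminates [x]; the new multiplier stays outside the prime. *)
  apply: (IH (u * (u - e))); first by rewrite prime_idealrM negb_or up.
  move=> y ys; have [|f fp yf] := sp y; first by rewrite inE ys orbT.
  rewrite (_ : _ * y = (u - e) * (u * y - f * x) + f * (u * x - e * x)); last ring.
  by apply: ideal_combD; exact: ideal_combM.
have /eqP : (u - e) * x = 0 by rewrite mulrBl; exact: ideal_comb_zero xe.
rewrite mulf_eq0 => /orP[/eqP ue|/eqP x0].
  by rewrite ue rpred0 in uep.
by move=> y; rewrite inE => /orP[/eqP ->|/s0].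
Qed.
End Nakayama.

Section ResidueClasses.
Variables (K : fieldExtType rat).
Local Notation OK := (ring_of_integers K).

Lemma intK_eq0 (z : int) : (z%:~R == 0 :> K) = (z == 0).
Proof. by rewrite -(rmorph_int (in_alg K)) scaler_eq0 oner_eq0 orbF intr_eq0. Qed.

Lemma oint_eq0 (z : int) : (z%:~R == 0 :> OK) = (z == 0).
Proof. by rewrite -(inj_eq val_inj) /= rmorph_int intK_eq0. Qed.

Lemma onat_eq0 (n : nat) : (n%:R == 0 :> OK) = (n == 0)%N.
Proof. by rewrite pmulrn oint_eq0. Qed.

Section Above.
Variables (l : nat) (r : prime_idealr OK).
Hypotheses (l_pr : prime l) (lr : l%:R \in r).

(** Otherwise r^n equals its product with r. It is generated by l^n and the representatives modulo
    l^n that lie in it, so Nakayama's lemma makes it zero, although it contains l^n. *)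
Lemma ideal_exp_strict n : exists2 x, idl_exp r n x & ~ idl_exp r n.+1 x.
Proof.
apply: contrapT => /forall2NP nx.
have nS x : idl_exp r n x -> idl_exp r n.+1 x.
  by move=> xn; apply: contrapT => xn'; have [] := nx x.
have ln0 : (l ^ n)%:Z != 0 by rewrite eqz_nat -lt0n expn_gt0 prime_gt0.
have [t tP] := finite_residues K ln0.
pose L : OK := l%:R ^+ n.
have LE : ((l ^ n)%:Z)%:~R = L by rewrite -pmulrn natrX.
pose s := L :: [seq b <- t | `[< idl_exp r n b >]].
have sE x : idl_exp r n x -> forall e, e \in r -> ideal_comb r s (e * x).
  move=> xn e er; have [b bt [c]] := tP x; rewrite LE => bc.
  have -> : e * x = e * b + (- c * e) * L.
    by rewrite (_ : b = x + L * c); [ring|rewrite -bc addrC subrK].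
  apply: ideal_combD.
    apply: ideal_comb_mem er; rewrite inE mem_filter bt andbT; apply/orP; right.
    apply/asboolP; rewrite -[b](subrK x) bc; apply: ideal_expD xn.
    exact: ideal_exp_pow.
  by apply: ideal_comb_mem; rewrite ?mem_head ?idealMr.
have Ls : L \in s by rewrite mem_head.
suff /(_ L Ls) : {in s, forall x, x = 0}.
  by move/eqP; rewrite expf_eq0 onat_eq0; apply/negP; move: (prime_gt0 l_pr); lia.
apply: (@nakayama _ r s 1) => [|x xs]; first by rewrite idealr1.
have /nS : idl_exp r n x.
  move: xs; rewrite inE => /orP[/eqP ->|].
    by rewrite -[L]mulr1; exact: ideal_exp_pow.
  by rewrite mem_filter => /andP[/asboolP].
rewrite mul1r => -[w wr ->].
suff: forall v, {subset v <= w} -> ideal_comb r s (\sum_(u <- v) u.1 * u.2).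
  exact.
elim=> [|u v IH] vw; first by rewrite big_nil; exact: ideal_comb0.
rewrite big_cons; apply: ideal_combD.
  by have [|ur un] := wr u; [apply: vw; rewrite mem_head|exact: sE].
by apply: IH => z zv; apply: vw; rewrite inE zv orbT.
Qed.

(** Some [w] in r^n outside r^(n+1) splits each class modulo r^n into at least [l] classes, through
    the multiples j w with j < l. *)
Lemma incongruent_seq n : exists g : nat -> OK, forall i j,
  (i < l ^ n)%N -> (j < l ^ n)%N -> idl_exp r n (g i - g j) -> i = j.
Proof.
elim: n => [|n [g gP]]; first by exists (fun=> 0) => i j; rewrite expn0; lia.
have [w wn wS] := ideal_exp_strict n.
have l0 := prime_gt0 l_pr.
exists (fun i => g (i %/ l)%N + (i %% l)%:R * w) => i j il jl ij.
have dE : (i %/ l = j %/ l)%N.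
  apply: gP; rewrite ?ltn_divLR // -?expnSr //.
  set a := (_ * w) in ij; set b := (_ * w) in ij.
  rewrite (_ : _ - _ = g (i %/ l)%N + a - (g (j %/ l)%N + b) - (a - b)); last ring.
  by apply: ideal_expB (ideal_expS ij) _; apply: ideal_expB; exact: ideal_expMl.
rewrite [i](divn_eq i l) [j](divn_eq j l) dE; congr (_ + _)%N.
apply/eqP; apply: contraT => ij'; exfalso; apply: wS.
apply: (@ideal_exp_cancel _ _ _ l_pr lr n.+1 ((i %% l)%:Z - (j %% l)%:Z)).
  have := ltn_pmod i l0; have := ltn_pmod j l0; move: ij'.
  set a := (i %% l)%N; set b := (j %% l)%N => ab bl al.
  by apply/negP => /dvdn_leq; lia.
by rewrite rmorphB /= -!pmulrn; move: ij; rewrite dE; congr (idl_exp _ _ _); ring.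
Qed.

Lemma missed_class n (s : seq OK) : (size s < l ^ n)%N ->
  exists a : OK, {in s, forall x, ~ idl_exp r n (x - a)}.
Proof.
move=> sn; apply: contrapT => nex; have [g gP] := incongruent_seq n.
have hit (i : 'I_(l ^ n)) : exists j : 'I_(size s), idl_exp r n (nth 0 s j - g i).
  apply: contrapT => ni; apply: nex; exists (g i) => x xs xg; apply: ni.
  by rewrite -index_mem in xs; exists (Ordinal xs); rewrite nth_index // -index_mem.
have /choice[h hP] := hit.
suff /leq_card : injective h by rewrite !card_ord leqNgt sn.
move=> i j hij; apply/val_inj/gP; rewrite ?ltn_ord //.
apply: ideal_exp_trans (hP j); rewrite -hij.
by apply: ideal_exp_subC.
Qed.
End Above.

Lemma integer_relation m (e : 'I_m -> OK) : (\dim {:K} < m)%N ->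
  exists2 c : 'I_m -> int, exists i, c i != 0 & \sum_i (c i)%:~R * e i = 0.
Proof.
move=> dm; pose X := [tuple oval (e i) | i < m].
have : ~~ free X.
  rewrite /free size_tuple; apply/eqP => dX.
  by have := dimvS (subvf <<X>>%VS); rewrite dX leqNgt dm.
move/freeP => /existsNP[a /not_implyP[aX /existsNP[i ai]]].
have [d d0 dP] := common_denominator a.
have /choice[c cP] := dP.
have dQ : (d%:~R : rat) != 0 by rewrite intr_eq0.
exists c.
  by exists i; rewrite -(intr_eq0 rat) -cP mulf_neq0 //; exact/eqP.
apply: val_inj; rewrite rmorph_sum /=.
transitivity (\sum_j d%:~R *: (a j *: X`_j)); last first.
  by rewrite -scaler_sumr aX scaler0.
apply: eq_bigr => j _;
transitivity (oval (c j)%:~R * oval (e j)) => //.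
rewrite rmorph_int scalerA cP (nth_map j) ?size_enum_ord //= nth_ord_enum.
by rewrite -[RHS]mulr_algl -scaler_int.
Qed.

(** Bounds the number of primes above [l] by the degree. If none contained another, there would be
    [e i] outside [r i] but in every other [r j]. In an integer relation between the [e i] each
    coefficient would lie in its [r i], hence be divisible by [l], and dividing the relation by [l]
    could go on forever. *)
Lemma primes_above_subset (l m : nat) (r : 'I_m -> prime_idealr OK) :
  prime l -> (forall i, l%:R \in r i) -> (\dim {:K} < m)%N ->
  exists i j, i != j /\ {subset r i <= r j}.
Proof.
move=> l_pr lr dm; apply: contrapT => nex.
have xP (ij : 'I_m * 'I_m) : exists x, ij.1 != ij.2 -> (x \in r ij.2) && (x \notin r ij.1).
  case: ij => i j /=; case: (eqVneq i j) => [|ij]; first by exists 0.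
  have /existsNP[x /not_implyP[xj /negP xi]] : ~ {subset r j <= r i}.
    by move=> ji; apply: nex; exists j, i; rewrite eq_sym.
  by exists x; rewrite xj.
have /choice[x {}xP] := xP.
pose e i := \prod_(j | j != i) x (i, j).
have e_in i j : i != j -> e i \in r j.
  by move=> ij; rewrite /e (bigD1 j) 1?eq_sym //= mulrC idealMr //; case/andP: (xP (i, j) ij).
have e_out i : e i \notin r i.
  rewrite /e; elim/big_rec: _ => [|j y ji yi]; first by rewrite idealr1.
  rewrite prime_idealrM negb_or yi andbT.
  by have := xP (i, j); rewrite /= eq_sym => /(_ ji)/andP[].
have [c [i ci] ce] := integer_relation e dm.
have l0 : (l%:R : OK) != 0 by rewrite onat_eq0 -lt0n prime_gt0.
have cl t : exists c', (forall i, c i = (l ^ t)%:Z * c' i) /\ \sum_i (c' i)%:~R * e i = 0.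
  elim: t => [|t [c' [cE c'e]]].
    by exists c; split=> // j; rewrite mul1r.
  have /choice[c2 c2P] j : exists z, c' j = l%:Z * z.
    have : (c' j)%:~R * e j \in r j.
      move/eqP: c'e; rewrite (bigD1 j) //= addr_eq0 => /eqP ->.
      by rewrite rpredN rpred_sum // => k kj; rewrite idealMr // e_in.
    rewrite prime_idealrM (negPf (e_out j)) orbF (int_in_ideal l_pr (lr j)) => /dvdnP[z zE].
    by exists (sgz (c' j) * z); rewrite {1}[c' j]intEsg zE; lia.
  exists c2; split=> [j|]; first by rewrite cE c2P expnSr PoszM mulrA.
  apply: (mulfI l0); rewrite mulr0 -[RHS]c'e mulr_sumr; apply: eq_bigr => j _.
  by rewrite c2P rmorphM /= -pmulrn mulrA.
have [c' [/(_ i) cE _]] := cl `|c i|%N.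
have := ltn_expl `|c i| (prime_gt1 l_pr).
have: (l ^ `|c i| <= `|c i|)%N.
  by rewrite dvdn_leq ?absz_gt0 // {2}cE abszM dvdn_mulr.
by rewrite leqNgt => /negP.
Qed.
End ResidueClasses.

(** * Primes of degree one *)

Lemma prime_idealr_ex (R : nzRingType) (S : R -> bool) :
  idealr_closed S -> prime_idealr_closed S ->
  exists p : prime_idealr R, forall x, (x \in p) = S x.
Proof.
move=> Si Sp.
pose iS := isIdealr.Build R S Si.
pose pS := isPrimeIdealrClosed.Build R S Sp.
pose p : prime_idealr R := HB.pack S iS pS.
by exists p.
Qed.

(* For k >= 2 and R the ring of integers of a number field, this says that p is
   unramified of residue degree one over l. *)
Definition degree_one (R : comNzRingType) (l k : nat) (p : prime_idealr R) : Prop :=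
  l%:R \in p /\ forall x, exists a : int, idl_exp p k (x - a%:~R).

Lemma degree_one_nat (R : comNzRingType) (l k : nat) (q : prime_idealr R) (x : R) :
  prime l -> degree_one l k q ->
  exists2 i : nat, (i < l ^ k)%N & idl_exp q k (x - i%:R).
Proof.
move=> l_pr [lq qint]; have [b bP] := qint x.
have lk0 : (0 < l ^ k)%N by rewrite expn_gt0 prime_gt0.
have lkZ : (l ^ k)%:Z != 0 by rewrite eqz_nat -lt0n.
pose i := `|(b %% (l ^ k)%:Z)%Z|%N.
have iE : i%:Z = (b %% (l ^ k)%:Z)%Z by rewrite /i gez0_abs // modz_ge0.
exists i; first by rewrite -ltz_nat iE ltz_pmod.
apply: ideal_exp_trans bP _.
rewrite {1}(divz_eq b (l ^ k)%:Z) -iE intrD intrM -!pmulrn natrX addrK mulrC.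
exact: ideal_exp_pow.
Qed.

(** Modulo p^2 an element of p is an integer multiple of l, and the error is a sum of products of
    two elements of p. Approximating both factors by multiples of l modulo p^(m+2) approximates
    their product modulo p^(m+3). *)
Lemma degree_one_exp (R : comNzRingType) (l : nat) (p : prime_idealr R) :
  l%:R \in p -> (forall x, exists a : int, x - a%:~R \in p) ->
  (forall x, x \in p -> exists c : int, idl_exp p 2 (x - l%:R * c%:~R)) ->
  forall k, degree_one l k p.
Proof.
move=> lp p1 p2 k; split=> // x.
have {}p2 m y : y \in p -> exists c : int, idl_exp p m.+2 (y - l%:R * c%:~R).
  move=> yp; elim: m => [|m IH] in y yp *; first exact: p2.
  have [c [s sp yE]] := p2 _ yp.
  suff: exists d : int, idl_exp p m.+3 (\sum_(u <- s) u.1 * u.2 - l%:R * d%:~R).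
    rewrite -yE => -[d dP]; exists (c + d).
    by move: dP; congr (idl_exp _ _ _); rewrite rmorphD; ring.
  elim: s sp {yE} => [|[u v] s IHs] sp.
    by exists 0; rewrite big_nil mulr0 subr0; exact: ideal_exp0.
  have [|d dP] := IHs; first by move=> w ws; apply: sp; rewrite inE ws orbT.
  have [/= up /ideal_exp1 vp] := sp _ (mem_head _ _).
  have [a aP] := IH _ up; have [b bP] := IH _ vp.
  exists (l%:Z * a * b + d); rewrite big_cons /=.
  rewrite (_ : _ - _ = v * (u - l%:R * a%:~R) + (l%:R * (a%:~R * (v - l%:R * b%:~R))) +
    (\sum_(j <- s) j.1 * j.2 - l%:R * d%:~R)); last first.
    by rewrite rmorphD !rmorphM /= -pmulrn; ring.
  apply: ideal_expD dP; apply: ideal_expD; first exact: ideal_expSM.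
  by apply: ideal_expSM => //; exact: ideal_expMl.
have [a ap] := p1 x; have [c cP] := p2 k _ ap.
exists (a + l%:Z * c); apply: (@ideal_exp_le _ _ _ k.+2); first by lia.
by move: cP; congr (idl_exp _ _ _); rewrite rmorphD rmorphM /= -pmulrn; ring.
Qed.

(** * The degree-one prime attached to a simple root modulo l *)

Section PrimeOfRoot.
Variables (R : comNzRingType) (theta : R) (D : int) (G : {poly int}) (l : nat) (a : int).
Local Notation ev h := (map_poly intr h).[theta].
Hypothesis D_span : forall x, exists h : {poly int}, D%:~R * x = ev h.
Hypothesis G_min : forall h : {poly int}, ev h = 0 -> exists r, h = G * r.
Hypothesis G_theta : ev G = 0.
Hypothesis l_pr : prime l.
Hypothesis lD : ~~ (l %| `|D|)%N.
Hypothesis lGa : (l %| `|G.[a]|)%N.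
Hypothesis lG'a : ~~ (l %| `|G^`().[a]|)%N.

Let dvd_l (z : int) := (l %| `|z|)%N.

Let dvd_lM z w : dvd_l (z * w) = dvd_l z || dvd_l w.
Proof. by rewrite /dvd_l abszM Euclid_dvdM. Qed.

Let dvd_lB z w : dvd_l z -> dvd_l w -> dvd_l (z - w).
Proof. by rewrite -![dvd_l _]/(l%:Z %| _)%Z => lz lw; rewrite rpredB. Qed.

Let dvd_lN z : dvd_l (- z) = dvd_l z.
Proof. by rewrite /dvd_l abszN. Qed.

Let dvd_lD : dvd_l D = false.
Proof. exact: negPf. Qed.

Let dvd_l0 : dvd_l 0. Proof. exact: dvdn0. Qed.

Let ev_dvd h : ev h = 0 -> dvd_l h.[a].
Proof. by move=> /G_min[r ->]; rewrite hornerM dvd_lM {1}/dvd_l lGa. Qed.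

Let evM g h : ev (g * h) = ev g * ev h.
Proof. by rewrite rmorphM hornerM. Qed.
Let evD g h : ev (g + h) = ev g + ev h.
Proof. by rewrite rmorphD hornerD. Qed.
Let evB g h : ev (g - h) = ev g - ev h.
Proof. by rewrite rmorphB hornerD hornerN. Qed.
Let evC c : ev c%:P = c%:~R.
Proof. by rewrite map_polyC hornerC. Qed.
Let evX : ev 'X = theta.
Proof. by rewrite map_polyX hornerX. Qed.

(** The kernel of the map to the field with [l] elements sending [theta] to [a]. Elements need not
    be polynomials in [theta], so they are first multiplied by [D], a unit modulo [l]. *)
Definition root_ideal (x : R) : bool :=
  `[< exists h : {poly int}, D%:~R * x = ev h /\ dvd_l h.[a] >].

Local Notation q := root_ideal.

Let inq x : (x \in (q : {pred R})) = q x. Proof. by []. Qed.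

(** Two choices of [h] differ by a multiple of [G], and [l] divides [G.[a]]. *)
Let qP x h : D%:~R * x = ev h -> q x = dvd_l h.[a].
Proof.
move=> xh; apply/asboolP/idP => [[h' [xh' h'a]]|ha]; last by exists h.
have /ev_dvd : ev (h - h') = 0 by rewrite evB -xh -xh' subrr.
rewrite hornerD hornerN => e; rewrite (_ : h.[a] = h.[a] - h'.[a] - - h'.[a]); last by ring.
by apply: dvd_lB => //; rewrite dvd_lN.
Qed.

Let q_ev h : q (ev h) = dvd_l h.[a].
Proof.
rewrite (@qP _ (D%:P * h)); last by rewrite evM evC.
by rewrite hornerM hornerC dvd_lM dvd_lD.
Qed.

Let q_idealr : idealr_closed q.
Proof.
split.
- by rewrite inq; have := q_ev 0%:P; rewrite evC hornerC mulr0z => ->; rewrite /dvd_l dvdn0.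
- rewrite inq; have := q_ev 1%:P; rewrite evC hornerC mulr1z => ->.
  by rewrite /dvd_l dvdn1 neq_ltn prime_gt1 ?orbT.
move=> x u v; rewrite !inq => qu qv.
have [hx hxE] := D_span x; have [hu huE] := D_span u; have [hv hvE] := D_span v.
have [h hE] := D_span (x * u + v).
rewrite (qP huE) in qu; rewrite (qP hvE) in qv; rewrite (qP hE).
have /ev_dvd : ev (D%:P * h - (hx * hu + D%:P * hv)) = 0.
  by rewrite evB evD !evM evC -hE -hxE -huE -hvE; ring.
rewrite hornerD hornerN hornerD !hornerM hornerC => e.
have : dvd_l (D * h.[a]).
  rewrite (_ : _ * _ = (D * h.[a] - (hx.[a] * hu.[a] + D * hv.[a])) - (- (hx.[a] * hu.[a]) - D * hv.[a])); last ring.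
  apply: dvd_lB => //; apply: dvd_lB; last by rewrite dvd_lM qv orbT.
  by rewrite dvd_lN dvd_lM qu orbT.
by rewrite dvd_lM dvd_lD.
Qed.

Let q_prime : prime_idealr_closed q.
Proof.
move=> u v; rewrite !inq.
have [hu huE] := D_span u; have [hv hvE] := D_span v; have [h hE] := D_span (u * v).
rewrite (qP huE) (qP hvE) (qP hE) -dvd_lM => ha.
have /ev_dvd : ev (D%:P * h - hu * hv) = 0.
  by rewrite evB !evM evC -hE -huE -hvE; ring.
rewrite hornerD hornerN !hornerM hornerC => e.
rewrite (_ : hu.[a] * hv.[a] = D * h.[a] - (D * h.[a] - hu.[a] * hv.[a])); last ring.
by apply: dvd_lB e; rewrite dvd_lM ha orbT.
Qed.

Lemma degree_one_of_root : exists q, forall k, @degree_one R l k q.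
Proof.
have [p pE] := prime_idealr_ex q_idealr q_prime.
have lp : l%:R \in p.
  by rewrite pE pmulrn -evC q_ev hornerC /dvd_l absz_nat.
exists p; apply: degree_one_exp => // [x|x xp].
  have [h hE] := D_span x.
  have [u [v uv]] := coprime_inv_mod l_pr 1 lD.
  (* [u] inverts [D] modulo [l], so this is the residue of [x]. *)
  exists (u * h.[a]); rewrite pE (@qP _ (h - (D * (u * h.[a]))%:P)); last first.
    by rewrite evB evC -hE rmorphM /=; ring.
  rewrite hornerD hornerN hornerC (_ : _ - _ = v * l%:Z * h.[a]).
    by rewrite !dvd_lM /dvd_l absz_nat dvdnn orbT.
  by rewrite -[X in X - _]mul1r -uv expn1; ring.
have [h hE] := D_span x.
have [u [v uv]] := coprime_inv_mod l_pr 1 lD.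
have l2 y : y \in p -> idl_exp p 2 (l%:R * y).
  by move=> yp; apply: ideal_expSM => //; apply/ideal_exp1.
pose pi := theta - a%:~R.
have evP g : exists2 w, w \in p & ev g = g.[a]%:~R + w.
  exists (ev (g - (g.[a])%:P)); last by rewrite evB evC; ring.
  by rewrite pE q_ev hornerD hornerN hornerC subrr dvd_l0.
have pip : pi \in p.
  rewrite pE (_ : pi = ev ('X - a%:P)); last by rewrite evB evX evC.
  by rewrite q_ev hornerD hornerN hornerC hornerX subrr dvd_l0.
have evF g : exists g1 : {poly int}, g = (g.[a])%:P + ('X - a%:P) * g1.
  have /factor_theorem[g1 g1E] : root (g - (g.[a])%:P) a.
    by rewrite /root hornerD hornerN hornerC subrr.
  by exists g1; rewrite mulrC -g1E; ring.
(* Expanding [G] at [a], the equation G(theta) = 0 gives pi G'(a) = - G(a) modulo p^2. Here [l]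
   divides G(a), and G'(a) is invertible modulo [l] because the root is simple. *)
have pi2 : exists c : int, idl_exp p 2 (pi - l%:R * c%:~R).
  have [g1 g1E] := evF G.
  have g1a : g1.[a] = G^`().[a].
    rewrite g1E derivD derivC derivM derivB derivX derivC !hornerE; ring.
  have [w wp wE] := evP g1.
  have [s [t st]] := coprime_inv_mod l_pr 1 lG'a.
  have /dvdnP[m mE] := lGa.
  have lc : G.[a] = l%:Z * (sgz G.[a] * m%:Z) by rewrite {1}[G.[a]]intEsg mE PoszM; ring.
  set c := _ * m%:Z in lc; clearbody c.
  have piE : pi * G^`().[a]%:~R = - (l%:R * c%:~R) - pi * w.
    have : ev G = G.[a]%:~R + pi * (g1.[a]%:~R + w).
      by rewrite {1}g1E evD evM evB evX !evC wE.
    rewrite G_theta g1a lc rmorphM /= -pmulrn => e.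
    by rewrite -[LHS]subr0 e; ring.
  exists (- c * s).
  rewrite (_ : pi - _ = - s%:~R * (pi * w) + t%:~R * (l%:R * pi)).
    apply: ideal_expD; last by apply: ideal_expMl; exact: l2.
    by apply: ideal_expMl; apply: ideal_expSM => //; exact/ideal_exp1.
  have {1}-> : pi = s%:~R * (pi * G^`().[a]%:~R) + t%:~R * (l%:R * pi).
    have one : s%:~R * G^`().[a]%:~R + t%:~R * l%:R = 1 :> R.
      by rewrite pmulrn -!rmorphM -rmorphD /= -[l in X in _ + X]expn1 st.
    rewrite -[LHS]mul1r -{1}one; ring.
  rewrite piE rmorphM rmorphN /=. ring.
have [c cP] := pi2.
have [h1 h1E] := evF h; have [w wp wE] := evP h1.
have : dvd_l h.[a] by rewrite -(qP hE) -pE.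
case/dvdnP=> m mE.
have lc : h.[a] = l%:Z * (sgz h.[a] * m%:Z) by rewrite {1}[h.[a]]intEsg mE PoszM; ring.
set d := _ * m%:Z in lc; clearbody d.
have xE : D%:~R * x = l%:R * d%:~R + pi * (h1.[a]%:~R + w).
  by rewrite hE {1}h1E evD evM evB evX !evC wE lc rmorphM /= -pmulrn.
exists (u * d + u * h1.[a] * c).
rewrite (_ : _ - _ = u%:~R * h1.[a]%:~R * (pi - l%:R * c%:~R) + u%:~R * (pi * w) + v%:~R * (l%:R * x)).
  apply: ideal_expD; last by apply: ideal_expMl; exact: l2.
  apply: ideal_expD; first exact: ideal_expMl.
  by apply: ideal_expMl; apply: ideal_expSM => //; exact/ideal_exp1.
have {1}-> : x = u%:~R * (D%:~R * x) + v%:~R * (l%:R * x).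
  rewrite pmulrn !mulrA -mulrDl -!rmorphM -rmorphD /=.
  by move: uv; rewrite expn1 => ->; rewrite mul1r.
rewrite xE rmorphD !rmorphM /=. ring.
Qed.

End PrimeOfRoot.

(** * Integer polynomials, integrality and bounded denominators *)

Local Notation pZtoQ := (map_poly (intr : int -> rat)).

Lemma int_poly_nonroot (F : {poly int}) (m : int) : F != 0 -> m != 0 ->
  exists x : nat, F.[m * x%:Z] != 0.
Proof.
move=> F0 m0; apply: contrapT => nx.
pose s := [seq m * x%:Z | x <- iota 0 (size F)].
have : (size s < size F)%N.
  apply: max_poly_roots => //.
    apply/allP => _ /mapP[x _ ->]; apply/eqP; apply: contrapT => Fx.
    by apply: nx; exists x; exact/eqP.
  by rewrite map_inj_uniq ?iota_uniq // => x y /(mulfI m0) [].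
by rewrite size_map size_iota ltnn.
Qed.

Lemma prime_gt_coprime_fact (l N : nat) : prime l -> ~~ (l %| N`!)%N -> (N < l)%N.
Proof.
move=> l_pr; apply: contraR; rewrite -leqNgt => lN.
by apply: dvdn_fact; rewrite prime_gt0.
Qed.

(* Schur's trick: if c = G(0) is nonzero, G(c P x) is c times a number congruent
   to 1 modulo P = (N + 3)!, all of whose prime factors exceed N. *)
Lemma int_poly_root_mod_prime (G : {poly int}) (N : nat) : (1 < size G)%N ->
  exists l a, [/\ prime l, (N < l)%N & (l %| `|G.[a]|)%N].
Proof.
move=> G1; set c := G.[0].
have [c0|c0] := eqVneq c 0.
  have [l Nl l_pr] := prime_above N.
  by exists l, 0; split=> //; rewrite -/c c0 dvdn0.
have [H HE] : exists H, G = c%:P + 'X * H.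
  have /factor_theorem[H HE] : root (G - c%:P) 0.
    by rewrite /root hornerD hornerN hornerC subrr.
  by exists H; rewrite -[G](subrK c%:P) HE subr0 addrC mulrC.
have H0 : H != 0.
  by apply: contraTneq G1 => H0; rewrite HE H0 mulr0 addr0 size_polyC c0.
pose P := (N.+3)`!; have P0 : P%:Z != 0 by rewrite eqz_nat -lt0n fact_gt0.
have [] := @int_poly_nonroot ('X * H) (c * P%:Z).
- by rewrite mulf_neq0 ?polyX_eq0.
- by rewrite mulf_neq0.
move=> x; set a := c * P%:Z * x%:Z; rewrite hornerM hornerX mulf_eq0 negb_or.
case/andP=> a0 Ha0.
have x0 : x%:Z != 0 by move: a0; rewrite /a mulf_eq0 negb_or => /andP[].
pose t := x%:Z * H.[a]; have t0 : t != 0 by rewrite mulf_neq0.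
have GE : G.[a] = c * (1 + P%:Z * t).
  by rewrite HE hornerD hornerM hornerC hornerX {1}/a /t; ring.
(* The shift by 3 in the factorial makes [P] large enough that 1 + P t is neither 1 nor -1 nor 0 for
   nonzero t, so it has a prime factor. *)
have P6 : (6 <= P)%N by rewrite /P !factS; move: (fact_gt0 N); nia.
pose v : int := 1 + P%:Z * t; pose w := `|v|%N.
have w1 : (1 < w)%N.
  rewrite /w /v; move: (t) t0 P6 => {x a a0 Ha0 x0 t GE w v} t t0 P6.
  have /orP[t1|t1] : (t <= -1) || (1 <= t) by lia.
    have : P%:Z * t <= - P%:Z by nia. by lia.
  have : P%:Z <= P%:Z * t by nia. by lia.
exists (pdiv w), a; split; first exact: pdiv_prime.
  suff : (N.+3 < pdiv w)%N by lia.
  apply: prime_gt_coprime_fact; first exact: pdiv_prime.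
  apply/negP => dP; have := pdiv_prime w1; have := pdiv_dvd w.
  rewrite -[(_ %| w)%N]/((pdiv w)%:Z %| v)%Z.
  rewrite rpredDr ?dvdz_mulr //.
  by rewrite dvdz1 absz_nat => /eqP ->.
by rewrite GE abszM dvdn_mull ?pdiv_dvd.
Qed.

(** Factors X are stripped from [q] until its constant term is nonzero; that constant is then a
    multiple of [x]. *)
Lemma int_multiple (R : idomainType) (q : {poly int}) (x : R) :
  q != 0 -> (map_poly intr q).[x] = 0 -> x != 0 ->
  exists2 n : int, n != 0 & exists s : {poly int}, n%:~R = (map_poly intr s).[x] * x.
Proof.
elim/poly_ind: q => [|q c IH]; first by rewrite eqxx.
rewrite rmorphD rmorphM /= map_polyX map_polyC hornerMXaddC => q0 qx x0.
have [c0|c0] := eqVneq c 0; last first.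
  exists c => //; exists (- q); rewrite rmorphN hornerN mulNr.
  by apply/eqP; rewrite -addr_eq0 addrC qx.
apply: IH => //; first by apply: contra q0 => /eqP ->; rewrite c0 mul0r addr0.
by move/eqP: qx; rewrite c0 /= ?mulr0z addr0 mulf_eq0 (negPf x0) orbF => /eqP.
Qed.

(** With a the leading coefficient and d the degree, a^(d-1) q(z) is a monic integer polynomial in a
    z. *)
Lemma integral_lead_coefM (R : idomainType) (q : {poly int}) (z : R) :
  (1 < size q)%N -> (map_poly intr q).[z] = 0 ->
  integralOver (intr : int -> R) ((lead_coef q)%:~R * z).
Proof.
move=> q1 qz; set a := lead_coef q; set d := (size q).-1.
have dE : size q = d.+1 by rewrite /d prednK // ltnW.
have d0 : (0 < d)%N by rewrite -ltnS -dE.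
(* The top index is set apart because the truncated exponent would give [a] instead of 1 there. *)
pose b (i : nat) : int := if i == d then 1 else q`_i * a ^+ (d.-1 - i).
have size_p : size (\poly_(i < d.+1) b i) = d.+1.
  by rewrite size_poly_eq // /b eqxx oner_eq0.
have am : a ^+ d.-1 *: q = \poly_(i < d.+1) (b i * a ^+ i).
  apply/polyP => i; rewrite coefZ coef_poly ltnS /b.
  have [id|di] := leqP i d; last by rewrite nth_default ?mulr0 // dE.
  have [->|id'] := eqVneq i d.
    by rewrite mul1r {2}/d -lead_coefE -/a mulrC -exprS prednK.
  by rewrite -mulrA -exprD mulrC subnK //; lia.
exists (\poly_(i < d.+1) b i).
  by rewrite monicE lead_coefE size_p coef_poly ltnSn /b eqxx.
rewrite /root; set y := _ * z.
have -> : map_poly intr (\poly_(i < d.+1) b i) = \poly_(i < d.+1) ((b i)%:~R : R).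
  by apply/polyP => i; rewrite coef_map !coef_poly; case: ifP.
rewrite horner_poly; apply/eqP.
transitivity ((map_poly intr (a ^+ d.-1 *: q)).[z] : R); last first.
  by rewrite linearZ hornerZ qz mulr0.
have -> : map_poly intr (a ^+ d.-1 *: q) = \poly_(i < d.+1) ((b i * a ^+ i)%:~R : R).
  by rewrite am; apply/polyP => i; rewrite coef_map !coef_poly; case: ifP.
rewrite horner_poly; apply: eq_bigr => i _.
by rewrite rmorphM rmorphXn /= -mulrA exprMn.
Qed.

Lemma det_Aint n (M : 'M[algC]_n) : (forall i j, M i j \in Aint) -> \det M \in Aint.
Proof.
move=> MA; rewrite /determinant rpred_sum // => s _.
by rewrite rpredM ?rpred_sign ?rpred_prod.
Qed.

Lemma Aint_int_multiple x : x \in Aint -> x != 0 ->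
  exists2 n : int, n != 0 & exists2 y, y \in Aint & n%:~R = y * x.
Proof.
move=> xA x0; have /floorpP[q qE] : minCpoly x \is a polyOver Num.int by [].
have q0 : q != 0.
  apply: contraTneq (minCpoly_monic x) => q0; rewrite qE q0 rmorph0.
  by rewrite monicE lead_coef0 eq_sym oner_eq0.
have [|n n0 [s sE]] := int_multiple q0 _ x0.
  by rewrite -qE; apply/eqP; exact: root_minCpoly.
exists n => //; exists (map_poly intr s).[x] => //.
apply: rpred_horner xA; apply/polyOverP => i; rewrite coef_map; exact: Aint_int.
Qed.

(* Cramer's rule for the Vandermonde system of the conjugates bounds the
   denominators of the coefficients of h. *)
Lemma bounded_denominators (rs : seq algC) : uniq rs -> {subset rs <= Aint} ->
  exists2 D : int, D != 0 & forall h : {poly rat}, (size h <= size rs)%N ->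
    (forall z, z \in rs -> (map_poly ratr h).[z] \in Aint) ->
    exists h' : {poly int}, D%:~R *: h = pZtoQ h'.
Proof.
move=> rs_uniq rsA; set n := size rs.
pose V := Vandermonde n (\row_(i < n) rs`_i).
have VE i j : V i j = rs`_j ^+ i by rewrite !mxE.
have rsA' (i : 'I_n) : rs`_i \in Aint by apply/rsA/mem_nth.
have VA i j : V i j \in Aint by rewrite VE rpredX.
have V0 : \det V != 0.
  rewrite det_Vandermonde; apply/prodf_neq0 => i _; apply/prodf_neq0 => j ij.
  by rewrite !mxE subr_eq0 nth_uniq // gtn_eqF.
have [D D0 [s sA DE]] := Aint_int_multiple (det_Aint VA) V0.
exists D => // h hn hA.
pose c := \row_(i < n) (ratr h`_i : algC).
have cVA j : (c *m V) 0 j \in Aint.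
  suff -> : (c *m V) 0 j = (map_poly ratr h).[rs`_j] by apply: hA; exact: mem_nth.
  rewrite (@horner_coef_wide _ n) ?size_map_poly // mxE.
  by apply: eq_bigr => i _; rewrite VE mxE coef_map.
have cA i : D%:~R * ratr h`_i \in Aint.
  have [ni|iN] := leqP n i.
    have -> : h`_i = 0 by apply: nth_default; exact: leq_trans ni.
    by rewrite rmorph0 mulr0 Aint0.
  have -> : D%:~R * ratr h`_i = s * (c *m V *m \adj V) 0 (Ordinal iN).
    by rewrite -mulmxA mul_mx_adj mul_mx_scalar mxE [c 0 _]mxE DE -mulrA.
  rewrite rpredM // mxE rpred_sum // => j _; rewrite rpredM // mxE.
  by rewrite rpredM ?rpred_sign // det_Aint // => u v; rewrite !mxE -VE.
have /choice[z zP] i : exists z : int, D%:~R * h`_i = z%:~R.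
  have /intrP[z zE] : (D%:~R * ratr h`_i : algC) \is a Num.int.
    by apply: Cint_rat_Aint (cA i); rewrite rpredM ?Crat_rat // rpred_int.
  exists z; apply: (fmorph_inj (ratr : rat -> algC)).
  by rewrite rmorphM !rmorph_int.
exists (\poly_(i < size h) z i); apply/polyP => i.
rewrite coefZ coef_map coef_poly zP; case: ltnP => //= hi.
by apply/eqP; rewrite -zP nth_default // mulr0.
Qed.

(** * Infinitely many degree-one primes in a number field *)

Section DegreeOnePrimes.
Variable K : fieldExtType rat.
Local Notation OK := (ring_of_integers K).
Local Notation pQtoK := (map_poly (in_alg K)).

Lemma pZtoQtoK (p : {poly int}) : pQtoK (pZtoQ p) = map_poly intr p.
Proof.
by rewrite -map_poly_comp; apply: eq_map_poly => z /=; rewrite -in_algE rmorph_int.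
Qed.

Lemma horner_oval (p : {poly int}) (x : OK) :
  (map_poly intr p).[oval x] = oval (map_poly intr p).[x].
Proof.
by rewrite -horner_map -map_poly_comp; congr (_.[_]); apply: eq_map_poly => z /=;
  rewrite rmorph_int.
Qed.

Lemma integer_multiple (z : K) : exists2 n : int, n != 0 & n%:~R * z \in @integer K.
Proof.
have /polyOver1P[g gE] := minPolyOver 1%AS z.
have [q [a a0 qE]] := rat_poly_scale g.
have q0 : q != 0.
  apply: contraTneq (monic_minPoly 1%AS z) => q0.
  by rewrite gE qE q0 !rmorph0 scaler0 rmorph0 monicE lead_coef0 eq_sym oner_eq0.
have qz : (map_poly intr q).[z] = 0.
  have := root_minPoly 1%AS z; rewrite gE qE linearZ /= pZtoQtoK /root hornerZ.
  by rewrite mulf_eq0 scaler_eq0 oner_eq0 orbF invr_eq0 intr_eq0 (negPf a0) => /eqP.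
have q1 : (1 < size q)%N.
  rewrite ltnNge; apply: contra q0 => /size1_polyC qC.
  by move/eqP: qz; rewrite qC map_polyC hornerC intK_eq0 polyC_eq0.
exists (lead_coef q); first by rewrite lead_coef_eq0.
by apply/asboolP; exact: integral_lead_coefM.
Qed.

Lemma integral_primitive_element :
  exists theta : OK, forall x : K, exists h : {poly rat}, x = (pQtoK h).[oval theta].
Proof.
pose z := separable_generator 1%AS {:K}%AS.
have KE : {:K}%AS = <<1; z>>%VS :> {vspace K}.
  apply: eq_adjoin_separable_generator; last exact: sub1v.
  apply/separableP => y _; apply: pcharf0_separable => p.
  by rewrite pchar_lalg pchar_num.
have [n n0 nz] := integer_multiple z.
exists (RingOfIntegers nz) => x /=.
have : x \in <<1; z>>%VS by rewrite -KE memvf.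
case/Fadjoin_polyP => _ /polyOver1P[h ->] ->.
exists (h \Po (n%:~R^-1 *: 'X)).
rewrite map_comp_poly horner_comp linearZ /= map_polyX hornerZ hornerX.
by rewrite -in_algE fmorphV rmorph_int mulKf ?intK_eq0.
Qed.

(** [G] is the minimal polynomial of an integral primitive element, made primitive over the
    integers, and [D] bounds the denominators of integers of K written in that element. A prime
    factor [l] of a value of [G], larger than |D| and the constant of a Bezout identity for [G] and
    its derivative, has a simple root to which [degree_one_of_root] applies. *)
Lemma degree_one_primes (N : nat) :
  exists l (q : prime_idealr OK), [/\ prime l, (N < l)%N & forall k, degree_one l k q].
Proof.
have [theta thP] := integral_primitive_element.
set t := oval theta in thP.
have /polyOver1P[g gE] := minPolyOver 1%AS t.
have g_min h : (pQtoK h).[t] = 0 -> g %| h.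
  move=> ht; rewrite -(dvdp_map (in_alg K)) -gE; apply: minPoly_dvdp; last exact/eqP.
  by apply/polyOver1P; exists h.
have g_t : (pQtoK g).[t] = 0 by rewrite -gE; apply/eqP; exact: root_minPoly.
have g0 : g != 0.
  by rewrite -(map_poly_eq0 (in_alg K)) -gE monic_neq0 ?monic_minPoly.
have g_sep : separable_poly g.
  rewrite -(separable_map (in_alg K)) -gE; apply: (pcharf0_separable 1%AS) => p.
  by rewrite pchar_lalg pchar_num.
pose gC := map_poly (ratr : rat -> algC) g.
have [rs rsE] := closed_field_poly_normal gC.
have lgC : lead_coef gC != 0 by rewrite lead_coef_eq0 map_poly_eq0.
have rs_uniq : uniq rs.
  rewrite -separable_prod_XsubC -(separable_map (ratr : rat -> algC)) in g_sep *.
  move: g_sep; rewrite -/gC rsE; apply: dvdp_separable.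
  by rewrite dvdpZr.
have size_rs : size g = (size rs).+1.
  by rewrite -(size_map_poly (ratr : rat -> algC)) -/gC rsE size_scale // size_prod_XsubC.
(* The conjugates of an integral element satisfy the same monic integer equation. *)
have conj_int (h : {poly rat}) : (pQtoK h).[t] \in @integer K ->
    forall z, z \in rs -> (map_poly ratr h).[z] \in Aint.
  move=> /asboolP[p p_mon /eqP pr] z zrs.
  have gz : root gC z by rewrite rsE rootZ // root_prod_XsubC.
  have : g %| (pZtoQ p \Po h).
    by apply: g_min; rewrite map_comp_poly horner_comp pZtoQtoK.
  rewrite -(dvdp_map (ratr : rat -> algC)) => /root_dvdp/(_ gz).
  rewrite map_comp_poly /root horner_comp -map_poly_comp => pz.
  apply: (@root_monic_Aint (map_poly intr p)).
  - rewrite /root; move: pz; congr (_.[_] == 0); apply: eq_map_poly => c /=.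
    by rewrite rmorph_int.
  - exact: monic_map.
  - by apply/polyOverP => i; rewrite coef_map rpred_int.
have rsA : {subset rs <= Aint}.
  move=> z zrs; have := @conj_int 'X.
  by rewrite !map_polyX hornerX => /(_ (ovalP theta) z zrs); rewrite hornerX.
have [D D0 DP] := bounded_denominators rs_uniq rsA.
have [g1 [a a0 g1E]] := rat_poly_scale g.
(* Primitivity turns divisibility over the rationals into divisibility over the integers, by Gauss's
   lemma. *)
pose G := zprimitive g1.
have D_span (x : OK) : exists h : {poly int}, D%:~R * x = (map_poly intr h).[theta].
  have [h hE] := thP (oval x).
  have {hE} hE : oval x = (pQtoK (h %% g)).[t].
    rewrite hE {1}(divp_eq h g) rmorphD rmorphM /= hornerD hornerM.
    by rewrite g_t mulr0 add0r.
  have [||h' h'E] := DP (h %% g).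
  - by rewrite -ltnS -size_rs ltn_modp.
  - by apply: conj_int; rewrite -hE ovalP.
  exists h'; apply: val_inj; rewrite /= -horner_oval -/t -pZtoQtoK -h'E linearZ hornerZ -hE.
  transitivity (oval D%:~R * oval x) => //; rewrite rmorph_int; congr (_ * _).
  by rewrite /= -in_algE rmorph_int.



have G_min (h : {poly int}) : (map_poly intr h).[theta] = 0 -> exists r, h = G * r.
  move=> ht; have : g %| pZtoQ h.
    by apply: g_min; rewrite pZtoQtoK horner_oval ht.
  by rewrite g1E dvdpZl ?invr_eq0 ?intr_eq0 // dvdp_rat_int => /dvdpP_int[r ->]; exists r.
have g1_0 : g1 != 0.
  by apply: contra g0 => /eqP g10; rewrite g1E g10 rmorph0 scaler0.
have gG : g = (a%:~R^-1 * (zcontents g1)%:~R) *: pZtoQ G.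
  by rewrite g1E {1}[g1]zpolyEprim linearZ /= scalerA.
have gG0 : (a%:~R^-1 * (zcontents g1)%:~R : rat) != 0.
  by rewrite mulf_neq0 ?invr_eq0 ?intr_eq0 ?zcontents_eq0.
have G_theta : (map_poly intr G).[theta] = 0.
  move: g_t; rewrite gG linearZ /= pZtoQtoK hornerZ horner_oval => /eqP.
  by rewrite mulf_eq0 scaler_eq0 oner_eq0 orbF (negPf gG0) => /eqP e; exact: val_inj.
have G0 : G != 0 by rewrite zprimitive_eq0.
have G1 : (1 < size G)%N.
  rewrite ltnNge; apply: contra G0 => /size1_polyC GC.
  by move/eqP: G_theta; rewrite GC map_polyC hornerC oint_eq0 polyC_eq0.
have : separable_poly (pZtoQ G) by move: g_sep; apply: dvdp_separable; rewrite gG dvdpZr.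
rewrite unlock deriv_map => /Bezout_eq1_coprimepP[[u v] /= uv].
have [u1 [b b0 uE]] := rat_poly_scale u; have [v1 [c c0 vE]] := rat_poly_scale v.
(* Denominators are cleared so that a prime not dividing [b * c] cannot divide both G(e) and
   G'(e). *)
have bez : (c *: u1) * G + (b *: v1) * G^`() = (b * c)%:P.
  apply: (map_inj_poly (f := intr : int -> rat)) => //; first exact: intr_inj.
  rewrite rmorphD !rmorphM /= !linearZ /= !map_polyC /=.
  have bQ : (b%:~R : rat) != 0 by rewrite intr_eq0.
  have cQ : (c%:~R : rat) != 0 by rewrite intr_eq0.
  rewrite -[RHS]mulr1 -uv uE vE -!mul_polyC.
  have bV : b%:~R%:P * b%:~R^-1%:P = 1 :> {poly rat} by rewrite -polyCM mulfV.
  have cV : c%:~R%:P * c%:~R^-1%:P = 1 :> {poly rat} by rewrite -polyCM mulfV.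
  transitivity ((b%:~R%:P * b%:~R^-1%:P) * (c%:~R%:P * (pZtoQ u1 * pZtoQ G)) +
    (c%:~R%:P * c%:~R^-1%:P) * (b%:~R%:P * (pZtoQ v1 * pZtoQ G^`())) : {poly rat}).
    by rewrite bV cV; ring.
  by ring.
pose m : int := b * c; have bc0 : m != 0 by rewrite mulf_neq0.
have [l [e [l_pr Nl lGe]]] := int_poly_root_mod_prime (N + `|D| + `|m|)%N G1.
have [||q qP] := @degree_one_of_root OK theta D G l e D_span G_min G_theta l_pr _ lGe.
- rewrite gtnNdvd ?absz_gt0 //; apply: leq_ltn_trans Nl.
  exact: leq_trans (leq_addl _ _) (leq_addr _ _).
- have : ~~ (l %| `|m|)%N.
    by rewrite gtnNdvd ?absz_gt0 //; apply: leq_ltn_trans Nl; exact: leq_addl.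
  apply: contra => lG'e.
  have := congr1 (fun p => p.[e]) bez; rewrite hornerD !hornerM !hornerZ hornerC => mE.
  have : (l%:Z %| c * u1.[e] * G.[e] + b * v1.[e] * G^`().[e])%Z.
    by rewrite rpredD // dvdz_mull.
  by rewrite mE.
exists l, q; split=> //; apply: leq_ltn_trans Nl.
by rewrite -addnA leq_addr.
Qed.

End DegreeOnePrimes.

(** * Additive maps reflecting admissibility *)

(** The prime-to-[l] part of N! is divisible by every prime up to [N] other than [l], and its [k]-th
    power is coprime to l^k. *)
Lemma chinese_idempotent (l k N : nat) : prime l ->
  exists e : nat, e = 1 %[mod l ^ k] /\
    forall l', prime l' -> l' != l -> (l' <= N)%N -> (l' ^ k %| e)%N.
Proof.
move=> l_pr; pose M := (N`!`_(l^') ^ k)%N.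
have co : coprime (l ^ k) M.
  rewrite coprimeXl // coprimeXr // -{1}(part_pnat_id (pnat_id l_pr)).
  by apply: coprime_partC.
exists (chinese (l ^ k) M 1 0); split; first exact: chinese_modl.
move=> l' l'_pr l'l l'N; apply: (@dvdn_trans M); last first.
  by have := chinese_modr co 1 0; rewrite mod0n => /eqP.
apply: dvdn_exp2r; rewrite -(part_pnat_id (_ : (l^'%N).-nat l')).
  by apply: partn_dvd; rewrite ?fact_gt0 // dvdn_fact // prime_gt0.
by rewrite p'natE // dvdn_prime2 // eq_sym.
Qed.

Lemma ideal_idempotent (R : comNzRingType) (l k N : nat) : prime l ->
  exists e : nat, (forall (r : idealr R) x, l%:R \in r -> idl_exp r k (e%:R * x - x)) /\
    forall l' (r : idealr R) x, prime l' -> l' != l -> (l' <= N)%N -> l'%:R \in r ->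
      idl_exp r k (e%:R * x).
Proof.
move=> l_pr; have [e [e1 e0]] := chinese_idempotent k N l_pr; exists e; split.
  move=> r x lr; rewrite -[X in _ - X]mul1r -mulrBl.
  suff [c ->] : exists c : int, e%:R - 1 = l%:R ^+ k * c%:~R :> R.
    by rewrite -mulrA; exact: ideal_exp_pow.
  have : (e%:Z == 1 %[mod (l ^ k)%:Z])%Z by rewrite !modz_nat e1.
  rewrite eqz_mod_dvd => /dvdzP[c cE]; exists c.
  have := congr1 (fun z => z%:~R : R) cE.
  by rewrite rmorphB rmorphM /= -!pmulrn natrX mulrC.
move=> l' r x l'_pr l'l l'N l'r; have /dvdnP[m ->] := e0 l' l'_pr l'l l'N.
by rewrite mulnC natrM natrX -mulrA; exact: ideal_exp_pow.
Qed.

Section AdditiveMaps.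
Variables (K : fieldExtType rat).
Local Notation OK := (ring_of_integers K).

Lemma prime_in_ideal (r : prime_idealr OK) : (exists2 x, x \in r & x != 0) ->
  exists2 l, prime l & l%:R \in r.
Proof.
case=> x xr x0; have [z z0 zr] := ideal_int_mem xr x0.
have : exists n, (0 < n)%N && (n%:R \in r).
  exists `|z|%N; rewrite absz_gt0 z0 pmulrn abszEsg.
  by rewrite rmorphM idealMr.
case/ex_minnP => n /andP[n0 nr] n_min.
have n1 : (1 < n)%N.
  by case: n n0 nr {n_min} => [|[|n]] // _; rewrite idealr1.
have := pdiv_dvd n; case/dvdnP => m mE.
move: nr; rewrite mE natrM prime_idealrM => /orP[mr|pr].
  have m0 : (0 < m)%N by case: m mE {mr} => // nE; rewrite nE in n0.
  have := n_min m; rewrite m0 mr => /(_ isT).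
  by rewrite leqNgt {1}mE ltn_Pmulr // prime_gt1 // pdiv_prime.
by exists (pdiv n) => //; exact: pdiv_prime.
Qed.

Lemma seq_not_admissible k (s : seq OK) :
  ~ admissible k (fun x => x \in s) ->
  exists2 r : prime_idealr OK, exists2 x, x \in r & x != 0 &
    forall a, exists2 x, x \in s & idl_exp r k (x - a).
Proof.
move=> /existsNP[r /not_implyP[rn0 ra]]; exists r => // a.
apply: contrapT => /forall2NP na; apply: ra; exists a => x xs xa.
by case: (na x).
Qed.

Variables (A : OK -> OK) (k : nat).
Hypothesis k_gt0 : (0 < k)%N.
Hypothesis A_additive : zmod_morphism A.
Hypothesis A_adm : forall s : seq OK,
  admissible k (fun x => x \in map A s) -> admissible k (fun x => x \in s).

Let bundled_A : {additive OK -> OK} :=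
  HB.pack A (GRing.isZmodMorphism.Build OK OK A A_additive).

Lemma additiveMint (n : int) x : A (n%:~R * x) = n%:~R * A x.
Proof. by rewrite !mulrzl; exact: (raddfMz bundled_A). Qed.

Lemma additiveMnat (n : nat) x : A (n%:R * x) = n%:R * A x.
Proof. by rewrite !mulr_natl; exact: (raddfMn bundled_A). Qed.

Lemma additiveD x y : A (x + y) = A x + A y.
Proof. exact: (raddfD bundled_A). Qed.

Lemma additiveB x y : A (x - y) = A x - A y.
Proof. exact: A_additive. Qed.

Lemma additive0 : A 0 = 0.
Proof. exact: (raddf0 bundled_A). Qed.

Lemma additiveN x : A (- x) = - A x.
Proof. exact: (raddfN bundled_A). Qed.

Section OverPrime.
Variables (l : nat) (q : prime_idealr OK).
Hypotheses (l_pr : prime l) (l_big : (\dim {:K} < l)%N) (lq : degree_one l k q).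

(** There are [l] indices and [l] exceeds the degree, so two of the primes are nested. The two
    indices lie below [l], so their difference can later be cancelled modulo [l]. *)
Lemma pigeonhole_above (P : nat -> prime_idealr OK -> Prop) :
  (forall c, (c < l)%N -> exists2 r : prime_idealr OK, l%:R \in r & P c r) ->
  exists c d (r s : prime_idealr OK), [/\ l%:R \in s, P c r, P d s,
    {subset r <= s} & ~~ (l %| `|c%:Z - d%:Z|)%N].
Proof.
move=> lP; have /choice[r rP] (c : 'I_l) : exists r : prime_idealr OK, l%:R \in r /\ P c r.
  by have [r lr Pr] := lP c (ltn_ord c); exists r.
have [|c [d [cd rcd]]] := primes_above_subset l_pr _ l_big (r := r).
  by move=> c; case: (rP c).
exists c, d, (r c), (r d); split=> //; try by case: (rP c); case: (rP d).
have cd' : (c : nat) != d by rewrite (inj_eq val_inj).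
have := ltn_ord c; have := ltn_ord d; move: cd'.
move: (c : nat) (d : nat) => {c d cd rcd} c d cd dl cl.
by rewrite gtnNdvd //; lia.
Qed.

(** Modulo q^k the head of [s c] is 0 and [t] fills the nonzero classes, so no [s c] is admissible,
    and neither is its image under [A]. *)
Lemma image_in_prime_above x : idl_exp q k x ->
  exists2 r : prime_idealr OK, l%:R \in r & idl_exp r k (A x).
Proof.
move=> xq; have l0 := prime_gt0 l_pr; have [lq1 _] := lq.
have [e [e1 e0]] := ideal_idempotent OK k (l ^ k) l_pr.
pose t := [seq e%:R * i%:R | i <- iota 1 (l ^ k).-1] : seq OK.
pose s (c : nat) := e%:R * (c%:R * x) :: t.
have size_s c : size (s c) = (l ^ k)%N.
  by rewrite /= size_map size_iota prednK // expn_gt0 l0.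
have [|c [d [r' [r [lr cP dP rr' cd]]]]] := @pigeonhole_above (fun c r =>
    forall a, exists2 y, y \in map A (s c) & idl_exp r k (y - a)).
  move=> c cl.
  have : ~ admissible k (fun x => x \in map A (s c)).
    move=> /A_adm /(_ q) [|a aP].
      by exists l%:R => //; rewrite onat_eq0 -lt0n.
    have [i ilt ai] := degree_one_nat a l_pr lq.
    have ia := ideal_exp_subC ai.
    case: (posnP i) => [i0|i0].
      apply: (aP (e%:R * (c%:R * x))); first by rewrite /= mem_head.
      move: ia; rewrite i0 sub0r => ia; apply: ideal_expD ia.
      by do 2!apply: ideal_expMl.
    apply: (aP (e%:R * i%:R)).
      rewrite inE; apply/orP; right; apply: (map_f (fun j : nat => e%:R * j%:R : OK)).
      by rewrite mem_iota i0 add1n prednK // expn_gt0 l0.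
    by apply: ideal_exp_trans ia; exact: e1.
  case/seq_not_admissible => r rn0 rP; exists r => //.
  have [l' l'_pr l'r] := prime_in_ideal rn0.
  suff /eqP <- : l' == l by [].
  (* A prime above another l' cannot be filled: if l' <= l^k, the factor [e] puts all images in the
     zero class and class 1 is missed; if l' > l^k, there are more classes than points. *)
  apply: contraT => l'l; exfalso; have [l'k|kl'] := leqP l' (l ^ k).
    have [_ /mapP[y ys ->] y1] := rP 1.
    have : idl_exp r k (A y).
      by move: ys; rewrite inE => /orP[/eqP ->|/mapP[i _ ->]];
        rewrite additiveMnat; apply: e0 l'r.
    move/ideal_expB/(_ y1); rewrite opprB addrC subrK.
    by move/(ideal_exp_mem k_gt0); rewrite idealr1.
  have [|a aP] := missed_class l'_pr l'r (n := k) (s := map A (s c)).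
    rewrite size_map size_s (leq_trans kl') // -{1}(expn1 l').
    by rewrite leq_exp2l ?prime_gt1.
  by have [y /aP] := rP a.
(* The l^k - 1 images of [t] miss a class, which only the head can fill. The heads for [c] and [d]
   therefore agree modulo r^k. *)
have [|a aP] := missed_class l_pr lr (n := k) (s := map A t).
  by rewrite !size_map size_iota prednK // expn_gt0 l0.
have head f : (forall a, exists2 y, y \in map A (s f) & idl_exp r k (y - a)) ->
    idl_exp r k (e%:R * (f%:R * A x) - a).
  move=> /(_ a)[y]; rewrite /= inE !additiveMnat => /orP[/eqP -> //|yt].
  by move/aP: yt.
have := ideal_expB (head c _) (head d dP).
rewrite (_ : _ - _ - _ = e%:Z%:~R * ((c%:Z - d%:Z)%:~R * A x)); last first.
  by rewrite rmorphB /= -!pmulrn; ring.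
move=> cdA; exists r => //.
apply: (ideal_exp_cancel l_pr lr cd).
rewrite -(subKr (e%:R * ((c%:Z - d%:Z)%:~R * A x)) (_ * A x)); apply: ideal_expB; last exact: e1.
apply: cdA => b; have [y yA yb] := cP b; exists y => //.
exact: ideal_exp_mono yb.
Qed.

(** Two values of c for which A(x + c y) lies in the same r^k give A(y) in r^k by subtraction, and
    then A(x). *)
Lemma images_in_prime_above x y : idl_exp q k x -> idl_exp q k y ->
  exists r : prime_idealr OK, [/\ l%:R \in r, idl_exp r k (A x) & idl_exp r k (A y)].
Proof.
move=> xq yq.
have [|c [d [r' [r [lr cP dP rr' cd]]]]] := @pigeonhole_above (fun c r =>
    idl_exp r k (A (x + c%:R * y))).
  move=> c _; have [|r lr rP] := @image_in_prime_above (x + c%:R * y); last by exists r.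
  by apply: ideal_expD => //; exact: ideal_expMl.
move: cP => /(ideal_exp_mono rr').
rewrite !(additiveD, additiveMnat) in dP * => cP; exists r.
have Ay : idl_exp r k (A y).
  apply: (ideal_exp_cancel l_pr lr cd).
  have := ideal_expB cP dP; congr (idl_exp _ _ _).
  by rewrite rmorphB /= -!pmulrn; ring.
split=> //; have := ideal_expB dP (ideal_expMl d%:R Ay).
by rewrite addrK.
Qed.
End OverPrime.

(** If an integer a represents x modulo q^k, then A(x) = a A(1) and A(x^2) = a^2 A(1) modulo some
    r^k, so the defect [z] lies in a prime above l. A nonzero [z] divides a nonzero integer [n],
    which excludes l > |n|. *)
Lemma additive_square x : A x * A x = A 1 * A (x * x).
Proof.
apply/eqP; rewrite -subr_eq0; set z := _ - _; apply: contraT => z0.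
have /asboolP[g g_mon gz] := ovalP z.
have [||n n0 [s sE]] := @int_multiple OK g z _ _ z0.
- exact: monic_neq0.
- by apply: val_inj; rewrite /= -horner_oval; exact/eqP.
have [l [q [l_pr l_big lq]]] := degree_one_primes K (\dim {:K} + `|n|)%N.
have [lq1 qint] := lq k; have [a aP] := qint x.
have a2P : idl_exp q k (x * x - (a * a)%:~R * 1).
  rewrite (_ : _ - _ = (x + a%:~R) * (x - a%:~R)); first exact: ideal_expMl.
  by rewrite rmorphM /=; ring.
have aP' : idl_exp q k (x - a%:~R * 1) by rewrite mulr1.
have [|r [lr]] := images_in_prime_above l_pr _ (lq k) aP' a2P.
  exact: leq_ltn_trans (leq_addr _ _) l_big.
rewrite !additiveB !additiveMint => xr xxr.
have zr : z \in r.
  apply: (ideal_exp_mem k_gt0).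
  rewrite (_ : z = (A x + a%:~R * A 1) * (A x - a%:~R * A 1) -
    A 1 * (A (x * x) - (a * a)%:~R * A 1)); last by rewrite /z rmorphM /=; ring.
  by apply: ideal_expB; exact: ideal_expMl.
have : n%:~R \in r by rewrite sE idealMr.
rewrite (int_in_ideal l_pr lr) gtnNdvd ?absz_gt0 //.
exact: leq_ltn_trans (leq_addl _ _) l_big.
Qed.

(** Polarisation of the identity for squares. *)
Lemma additive_mul x y : A x * A y = A 1 * A (x * y).
Proof.
have n2 : (2%:R : OK) != 0 by rewrite onat_eq0.
apply: (mulfI n2).
transitivity (A (x + y) * A (x + y) - A x * A x - A y * A y).
  by rewrite additiveD; ring.
rewrite !additive_square (_ : (x + y) * (x + y) = x * x + y * y + 2%:R * (x * y)); last ring.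
by rewrite !additiveD additiveMnat; ring.
Qed.
End AdditiveMaps.

(** * Extended symmetries *)

Section Symmetries.
Variables (K : fieldExtType rat) (k : nat).
Local Notation OK := (ring_of_integers K).
Local Notation D := (admissible_system K k).

Definition sval_set (S : D) : OK -> bool := \val S.

Lemma sval_set_inj (S T : D) : sval_set S =1 sval_set T -> S = T.
Proof. by move=> ST; apply: val_inj; apply/funext. Qed.

Lemma admissibleW (S T : {ptws OK -> bool}) :
  (forall x, S x -> T x) -> admissible k T -> admissible k S.
Proof.
by move=> ST Ta p pn0; have [a aP] := Ta p pn0; exists a => x /ST; exact: aP.
Qed.

Lemma sval_set_admissible (S : D) : admissible k (sval_set S).
Proof. exact: set_valP. Qed.

Definition admissible_point (S : {ptws OK -> bool}) (Sa : admissible k S) : D :=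
  exist (fun S => S \in admissible k) S (mem_set Sa).

(** Agreement with [S] on finite windows generates a filter that converges to [S] in each
    coordinate, hence in the product topology. *)
Lemma ptws_nbhs_window (S : {ptws OK -> bool}) (V : set {ptws OK -> bool}) :
  nbhs S V -> exists W : seq OK, forall T : {ptws OK -> bool},
    {in W, T =1 S} -> V T.
Proof.
pose G := filter_from [set: seq OK] (fun W => [set T : {ptws OK -> bool} | {in W, T =1 S}]).
have GF : Filter G.
  apply: filter_from_filter; first by exists [::].
  move=> W W' _ _; exists (W ++ W') => // T TS.
  by split=> x xW; apply: TS; rewrite mem_cat xW ?orbT.
suff : G --> S by move=> GS /GS[W _ WV]; exists W.
apply/cvg_sup => x A.
case=> _ [[B oB <-] BS BA]; exists [:: x] => // T TS; apply: BA.
by rewrite /= TS ?mem_head.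
Qed.

Lemma continuous_window (f : D -> D) (S : D) (y : OK) : continuous f ->
  exists W : seq OK, forall T : D, {in W, sval_set T =1 sval_set S} ->
    sval_set (f T) y = sval_set (f S) y.
Proof.
move=> fc; pose P : set {ptws OK -> bool} := [set T | T y = sval_set (f S) y].
have Pn : nbhs (\val (f S) : {ptws OK -> bool}) P.
  rewrite (_ : P = (fun T : {ptws OK -> bool} => T y) @^-1` [set sval_set (f S) y]) //.
  apply: (@proj_continuous OK (fun=> bool) y).
  exact: discrete_set1.
have : nbhs S ((fun T : D => (\val (f T) : {ptws OK -> bool})) @^-1` P).
  apply: (@continuous_comp D D {ptws OK -> bool} f (fun T => \val T)) Pn; first exact: fc.
  exact: initial_continuous.
case=> _ [[V oV <-] VS VB].
have [W WV] := ptws_nbhs_window (open_nbhs_nbhs (conj oV VS)).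
exists W => T TW; apply: VB; exact: WV.
Qed.

Lemma sval_translate (g : OK) (S : D) y :
  sval_set (ds_act g S) y = sval_set S (y - g).
Proof. exact: translateE. Qed.

Lemma ext_sym_translate (f : D -> D) (A : OK -> OK) g (S : D) y :
  extended_symmetry f A -> sval_set (f (ds_act g S)) y = sval_set (f S) (y - A g).
Proof. by case=> _ _ fA; rewrite fA sval_translate. Qed.

Lemma extended_symmetry_inv (f : D -> D) (A : OK -> OK) :
  extended_symmetry f A -> exists B g, [/\ cancel A B, cancel B A, cancel f g,
    cancel g f & extended_symmetry g B].
Proof.
case=> [[Aadd [B AK BK]] [g [fK gK fc gc]] fA]; exists B, g; split=> //; split.
- by split; [exact: zmod_morphism_inv Aadd AK BK|exists A].
- by exists f.
- by move=> a x; apply: (can_inj fK); rewrite fA !gK BK.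
Qed.

Lemma not_admissible_full (S : D) : ~ (forall x, sval_set S x).
Proof.
move=> Sx; have [l [q [l_pr _ lq]]] := degree_one_primes K 0.
have [lq1 _] := lq k; have [|a aP] := sval_set_admissible S (p := q).
  by exists l%:R => //; rewrite onat_eq0 -lt0n prime_gt0.
by apply: (aP a) => //; rewrite subrr; exact: ideal_exp0.
Qed.

Lemma admissible_set0 : admissible k (fun _ : OK => false).
Proof. by move=> p _; exists 0. Qed.

(** The image of a point fixed by all translations is again fixed; if nonempty, it would be the
    whole ring. *)
Lemma ext_sym_set0 (f : D -> D) (A : OK -> OK) y : extended_symmetry f A ->
  sval_set (f (admissible_point admissible_set0)) y = false.
Proof.
move=> fA; apply/negbTE/negP => fy; set S0 := admissible_point _ in fy.
have [[_ [B AK BK]] _ _] := fA.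
apply: (@not_admissible_full (f S0)) => x.
have S0_fixed g : ds_act g S0 = S0 by apply: sval_set_inj => z; rewrite sval_translate.
have := ext_sym_translate (B (x - y)) S0 x fA.
by rewrite S0_fixed BK subKr fy.
Qed.

Lemma nonzero_avoid_primes (Z : seq OK) : 0 \notin Z ->
  exists N : nat, forall l (r : prime_idealr OK), prime l -> (N < l)%N ->
    l%:R \in r -> {in Z, forall z, z \notin r}.
Proof.
elim: Z => [|z Z IH]; first by exists 0%N.
rewrite inE negb_or eq_sym => /andP[z0 /IH[N NP]].
have /asboolP[g g_mon gz] := ovalP z.
have [||n n0 [s sE]] := @int_multiple OK g z _ _ z0.
- exact: monic_neq0.
- by apply: val_inj; rewrite /= -horner_oval; exact/eqP.
exists (N + `|n|)%N => l r l_pr Nl lr x; rewrite inE => /orP[/eqP ->|]; last first.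
  by apply: (NP l r) => //; exact: leq_ltn_trans (leq_addr _ _) Nl.
apply/negP => zr; have : n%:~R \in r by rewrite sE idealMr.
rewrite (int_in_ideal l_pr lr) gtnNdvd ?absz_gt0 //.
exact: leq_ltn_trans (leq_addl _ _) Nl.
Qed.

Lemma avoid_finite (m : nat) (b : OK) (L : seq OK) : (0 < m)%N ->
  exists z : OK, b + m%:R * z \notin L.
Proof.
move=> m0; apply: contrapT => nz.
pose t := [seq b + m%:R * j%:R | j <- iota 0 (size L).+1] : seq OK.
have : (size t <= size L)%N.
  apply: uniq_leq_size => [|_ /mapP[j _ ->]].
    rewrite map_inj_uniq ?iota_uniq // => i j /addrI /mulfI.
    rewrite onat_eq0 -lt0n m0 => /(_ isT) /eqP.
    rewrite -subr_eq0 !pmulrn -rmorphB oint_eq0 subr_eq0.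
    by move=> /eqP [].
  by apply: contrapT => /negP jL; apply: nz; exists j%:R.
by rewrite size_map size_iota ltnn.
Qed.

(** Supplies test points with prescribed classes modulo [m], so far apart that a window [W] placed
    at one of them contains no other. They are chosen greedily, avoiding finitely many values each
    time. *)
Lemma spread (m : nat) (b : nat -> OK) (I : seq nat) (F W : seq OK) :
  (0 < m)%N -> uniq I -> exists c : nat -> OK, [/\
    {in I, forall i, exists z, c i = b i + m%:R * z},
    {in I, forall i, c i \notin F} &
    {in I &, forall i j, i != j -> c i - c j \notin W}].
Proof.
move=> m0; elim: I => [|i I IH] /=; first by exists b.
case/andP=> iI /IH[c [cb cF cW]].
have [z] := avoid_finite (b i)
  (F ++ [seq c j + w | j <- I, w <- W] ++ [seq c j - w | j <- I, w <- W]) m0.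
set x := b i + _; rewrite !mem_cat !negb_or => /and3P[xF xW xW'].
exists (fun j => if j == i then x else c j).
have ne j : j \in I -> (j == i) = false by move=> jI; apply: contraNF iI => /eqP <-.
split=> [j|j|j j']; rewrite ?inE.
- by case: eqP => [-> _|_ /cb //]; exists z.
- by case: eqP => [-> _ //|_ /cF].
- case: (eqVneq j i) => [->|ji]; case: (eqVneq j' i) => [->|j'i] //= jI j'I jj'.
  + apply: contra xW => xW; apply/allpairsP; exists (j', x - c j').
    by split=> //=; rewrite addrC subrK.
  + apply: contra xW' => xW'; apply/allpairsP; exists (j, c j - x).
    by split=> //=; rewrite subKr.
  + exact: cW.
Qed.

Lemma singleton_admissible (x : OK) : (0 < k)%N -> admissible k (fun y => y == x).
Proof.
move=> k0 p _; exists (x + 1) => y /eqP ->.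
rewrite opprD addNKr => /ideal_expN; rewrite opprK => /(ideal_exp_mem k0).
by rewrite idealr1.
Qed.
End Symmetries.

(** * Symmetries on finite sets and their extension by continuity *)

Section FiniteSets.
Variables (K : fieldExtType rat) (k : nat).
Local Notation OK := (ring_of_integers K).
Local Notation D := (admissible_system K k).
Hypothesis k_gt0 : (0 < k)%N.

Lemma finite_image_subset (f : D -> D) (A : OK -> OK) (S1 S : D) (s : seq OK) y :
  extended_symmetry f A -> (forall x, sval_set S1 x = (x == 0)) ->
  sval_set (f S1) 0 -> (forall x, sval_set S x = (x \in s)) ->
  sval_set (f S) y -> y \in map A s.
Proof.
move=> fA S1E f10 SE fy; have [[Aadd [B AK BK]] [_ [_ _ fc _]] _] := fA.
(* The empty set is separated because the construction needs a base point [s0] in [s]. *)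
case: s => [|s0 s'] in SE *.
  have S0 : S = admissible_point (@admissible_set0 K k).
    by apply: sval_set_inj => x; rewrite SE.
  by have := ext_sym_set0 y fA; rewrite -S0 fy.
set s := s0 :: s' in SE *; apply: contraT => ynA; exfalso.
(* A large [p] separates [y] from the image of [s] and the points of that image from each other. *)
have [|N NP] := @nonzero_avoid_primes K ([seq y - A x | x <- s] ++
    [seq u <- [seq A x - A z | x <- s, z <- s] | u != 0]).
  apply/negP; rewrite mem_cat => /orP[/mapP[x xs] /esym/eqP|]; last first.
    by rewrite mem_filter eqxx.
  by rewrite subr_eq0 => /eqP yA; rewrite yA map_f in ynA.
have [l [p [l_pr Nl lp]]] := degree_one_primes K N.
have [lp1 pint] := lp k; have l0 := prime_gt0 l_pr.
have pA x z : x \in s -> z \in s -> idl_exp p k (A x - A z) -> x = z.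
  move=> xs zs /(ideal_exp_mem k_gt0) xz; apply: (can_inj AK); apply/eqP.
  rewrite -subr_eq0; apply: contraT => xz0.
  have := NP l p l_pr Nl lp1 (A x - A z); rewrite xz => /(_ _)/negP[] //.
  rewrite mem_cat mem_filter xz0; apply/orP; right.
  by apply/allpairsP; exists (x, z).
have py x : x \in s -> ~ idl_exp p k (y - A x).
  move=> xs /(ideal_exp_mem k_gt0) yx.
  by have := NP l p l_pr Nl lp1 (y - A x); rewrite yx mem_cat (map_f (fun z => y - A z) xs) => /(_ isT).
(* r i lifts the class i of O / p ^ k along A, within s whenever possible, so
   that s and the other lifts stay within fewer than l ^ k classes modulo l ^ k. *)
have /choice[r rP] (i : nat) : exists x, idl_exp p k (A x - i%:R) /\
    forall z, z \in s -> idl_exp p k (A z - i%:R) -> x = z.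
  have [[x xs xi]|nx] := pselect (exists2 x, x \in s & idl_exp p k (A x - i%:R)).
    exists x; split=> // z zs zi; apply: pA => //.
    by apply: ideal_exp_trans xi _; exact: ideal_exp_subC.
  exists (B i%:R); split; first by rewrite BK subrr; exact: ideal_exp0.
  by move=> z zs zi; case: nx; exists z.
pose I := [seq i <- iota 0 (l ^ k) | ~~ `[< idl_exp p k (y - i%:R) >]].
have I_uniq : uniq I by rewrite filter_uniq ?iota_uniq.
have sizeI : (size I < l ^ k)%N.
  rewrite size_filter -[X in (_ < X)%N](size_iota 0) -[X in (_ < X)%N](count_predC
    (fun i : nat => `[< idl_exp p k (y - i%:R) >])) addnC -[X in (X < _)%N]addn0.
  rewrite ltn_add2l -has_count; apply/hasP.
  have [i il yi] := degree_one_nat y l_pr (lp k).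
  by exists i; [rewrite mem_iota|apply/asboolP].
have sR x : x \in s -> x \in map r I.
  move=> xs; have [i il xi] := degree_one_nat (A x) l_pr (lp k).
  rewrite -(proj2 (rP i) x xs xi) map_f // mem_filter mem_iota leq0n il !andbT.
  apply/negP => /asboolP yi; apply: (py x xs).
  by apply: ideal_exp_trans yi _; exact: ideal_exp_subC.
(* [N2] exceeds the size of [T] below: primes above larger rational primes have too many classes to
   be filled, and the others are handled by congruences. *)
pose N2 := (l ^ k + size s)%N.
have [e [e1 e0]] := ideal_idempotent OK k N2 l_pr.
have [W0 W0P] := continuous_window S1 0 fc.
have [W1 W1P] := continuous_window S y fc.
have m0 : (0 < N2`! ^ k)%N by rewrite expn_gt0 fact_gt0.
(* [c i] is congruent to [r i] at primes above [l] and to [s0] at primes above the other rational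
   primes up to [N2]. It avoids the window [W1], and the window [W0] placed at [c i] contains no
   point of [s], except possibly [c i], which is excluded whenever 0 is in [W0]. *)
have [c [cb cF cW]] := @spread K (N2`! ^ k) (fun i => s0 + e%:R * (r i - s0)) I
  (W1 ++ [seq x - w | x <- s, w <- W0]) W0 m0 I_uniq.
pose T := s ++ map c I.
have sizeT : (size T < N2)%N by rewrite size_cat size_map addnC /N2 ltn_add2r.
have mP l' (q : prime_idealr OK) z : prime l' -> l'%:R \in q -> (l' <= N2)%N ->
    idl_exp q k ((N2`! ^ k)%:R * z).
  move=> l'_pr l'q l'N; have /dvdnP[d dE] : (l' ^ k %| N2`! ^ k)%N.
    by rewrite dvdn_exp2r // dvdn_fact // prime_gt0.
  by rewrite dE mulnC natrM natrX -mulrA; exact: ideal_exp_pow.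
have lN : (l <= N2)%N.
  by apply: leq_trans (leq_addr _ _); rewrite -{1}(expn1 l) leq_exp2l ?prime_gt1.
have cr (q : prime_idealr OK) i : l%:R \in q -> i \in I -> idl_exp q k (c i - r i).
  move=> lq iI; have [z ->] := cb i iI.
  rewrite (_ : _ - _ = (N2`! ^ k)%:R * z + (e%:R * (r i - s0) - (r i - s0))); last by ring.
  by apply: ideal_expD; [exact: mP lN|exact: e1].
(* Above l' > N2 there are too few points. Above [l] all points lie in the fewer than l^k classes of
   the [r i]. Elsewhere the new points fall in the class of [s0], which [S] already meets. *)
have T_adm : admissible k (fun x => x \in T).
  move=> q qn0; have [l' l'_pr l'q] := prime_in_ideal qn0.
  have [l'N|Nl'] := leqP l' N2; last first.
    have [|a aP] := missed_class l'_pr l'q (n := k) (s := T); last by exists a => x /aP.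
    by rewrite (ltn_trans sizeT) // (leq_trans Nl') // -{1}(expn1 l') leq_exp2l ?prime_gt1.
  have [ll'|l'l] := eqVneq l' l.
    have lq : l%:R \in q by rewrite -ll'.
    have [|a aP] := missed_class l_pr lq (n := k) (s := map r I); first by rewrite size_map.
    exists a => x; rewrite mem_cat => /orP[/sR/aP //|/mapP[i iI ->]] ca.
    apply: (aP (r i)); first exact: map_f.
    by apply: ideal_exp_trans ca; apply: ideal_exp_subC; exact: cr.
  have [a aP] := sval_set_admissible S qn0; exists a => x.
  rewrite mem_cat => /orP[xs|/mapP[i iI ->]] xa; first by apply: (aP x) => //; rewrite SE.
  apply: (aP s0); first by rewrite SE mem_head.
  apply: ideal_exp_trans xa; apply: ideal_exp_subC.
  have [z ->] := cb _ iI; rewrite addrAC [s0 + _]addrC addrK.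
  apply: ideal_expD; last exact: mP l'N.
  exact: e0 l'q.
pose T' : D := admissible_point T_adm.
have yT : sval_set (f T') y.
  rewrite W1P // => w wW; rewrite SE /sval_set /= mem_cat; case: (w \in s) => //=.
  apply/negP => /mapP[i iI wc]; have := cF i iI.
  by rewrite mem_cat -wc wW.
(* Translated by [- c i], the set [T] looks like {0} through [W0], so its image contains 0. *)
have cT i : i \in I -> sval_set (f T') (A (c i)).
  move=> iI; have := ext_sym_translate (- c i) T' 0 fA.
  rewrite (additiveN Aadd) opprK add0r => <-; rewrite W0P // => w wW.
  rewrite sval_translate opprK S1E /sval_set /= mem_cat.
  apply/orP/eqP => [[ws|/mapP[j jI wc]]|->].
  - have := cF i iI; rewrite mem_cat negb_or => /andP[_ /negP[]].
    by apply/allpairsP; exists (w + c i, w); split=> //=; rewrite addrC addKr.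
  - have wE : w = c j - c i by rewrite -wc addrK.
    have [ij|ij] := eqVneq j i; first by rewrite wE ij subrr.
    by have := cW j i jI iI ij; rewrite -wE wW.
  - by right; rewrite add0r map_f.
(* The class of [y] is met by [y] and every other class by some A(c i), so none is left to be
   missed. *)
have [|a aP] := sval_set_admissible (f T') (p := p).
  by exists l%:R => //; rewrite onat_eq0 -lt0n.
have [i il ai] := degree_one_nat a l_pr (lp k).
have [yi|yi] := pselect (idl_exp p k (y - i%:R)).
  by apply: (aP y) => //; apply: ideal_exp_trans yi _; exact: ideal_exp_subC.
have iI : i \in I.
  by rewrite mem_filter mem_iota leq0n il !andbT; apply/negP => /asboolP.
apply: (aP (A (c i))); first exact: cT.
apply: (@ideal_exp_trans _ _ _ (A (r i))); last first.
  by apply: ideal_exp_trans (proj1 (rP i)) _; exact: ideal_exp_subC.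
have [z ->] := cb i iI.
rewrite !(additiveD Aadd) !(additiveMnat Aadd) (additiveB Aadd).
rewrite (_ : _ - _ = (N2`! ^ k)%:R * A z + (e%:R * (A (r i) - A s0) - (A (r i) - A s0))); last by ring.
by apply: ideal_expD; [exact: mP lN|exact: e1].
Qed.

(** The inclusion first shows that [f] fixes {0}, so [g] is normalised as well. As f(S) is finite,
    the inclusion for [g] applies to it and gives the converse. *)
Lemma ext_sym_finite (f g : D -> D) (A B : OK -> OK) (S1 S : D) (s : seq OK) y :
  cancel A B -> cancel B A -> cancel f g ->
  extended_symmetry f A -> extended_symmetry g B ->
  (forall x, sval_set S1 x = (x == 0)) -> sval_set (f S1) 0 ->
  (forall x, sval_set S x = (x \in s)) ->
  sval_set (f S) y = (y \in map A s).
Proof.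
move=> AK BK fK fA gB S1E f10 SE; have [[Aadd _] _ _] := fA.
have fsub S' s' y' := @finite_image_subset f A S1 S' s' y' fA S1E f10.
have f1 : f S1 = S1.
  apply: sval_set_inj => x; rewrite S1E; apply/idP/eqP => [fx|-> //].
  have /mapP[z] : x \in map A [:: 0] by apply: fsub fx => z; rewrite S1E inE.
  by rewrite inE => /eqP -> ->; exact: additive0.
have g10 : sval_set (g S1) 0 by rewrite -{1}f1 fK S1E.
apply/idP/idP => [/(fsub _ _ _ SE) //|/mapP[x xs ->]].
have fSE z : sval_set (f S) z = (z \in [seq u <- map A s | sval_set (f S) u]).
  by rewrite mem_filter; apply/idP/andP => [fz|[]//]; split=> //; exact: fsub fz.
have : x \in map B [seq u <- map A s | sval_set (f S) u].
  by apply: (finite_image_subset gB S1E g10 fSE); rewrite fK SE.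
by case/mapP=> z; rewrite mem_filter => /andP[fz _] ->; rewrite BK.
Qed.

Lemma ext_sym_shape (f : D -> D) (A B : OK -> OK) :
  extended_symmetry f A -> cancel A B -> cancel B A ->
  exists t, (forall S y, sval_set (f S) y = sval_set S (B (y - t))) /\
    forall s : seq OK,
      admissible k (fun x => x \in map A s) -> admissible k (fun x => x \in s).
Proof.
move=> fA AK BK.
pose S1 : D := admissible_point (singleton_admissible 0 k_gt0).
have S1E x : sval_set S1 x = (x == 0) by [].
have [Aadd [g0 [f0K _ _ _]] _] := fA.
(* By injectivity {0} is not sent to the empty set, which is the image of itself. *)
have [t ft] : exists t, sval_set (f S1) t.
  apply: contrapT => nt; have /(congr1 g0) : f S1 = f (admissible_point (@admissible_set0 K k)).
    apply: sval_set_inj => x; rewrite (ext_sym_set0 _ fA).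
    by apply/negbTE/negP => fx; apply: nt; exists x.
  rewrite !f0K => /(congr1 (fun S => sval_set S 0)).
  by rewrite S1E eqxx.
pose h : D -> D := ds_act (- t) \o f.
have hA : extended_symmetry h A.
  have [_ [g [fK gK fc gc]] fAct] := fA; split=> //.
    exists (g \o ds_act t); split.
    - by move=> S; rewrite /h /comp -ds_actD addrN ds_act0 fK.
    - by move=> S; rewrite /h /comp gK -ds_actD addNr ds_act0.
    - by move=> S; apply: continuous_comp; [exact: fc|exact: ds_act_continuous].
    - by move=> S; apply: continuous_comp; [exact: ds_act_continuous|exact: gc].
  by move=> a S; rewrite /h /comp fAct -!ds_actD addrC.
have h10 : sval_set (h S1) 0 by rewrite /h /comp sval_translate opprK add0r.
have [B' [g [AK' BK' hK gK gB']]] := extended_symmetry_inv hA.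
have BB : B' = B by apply/funext => x; rewrite -[in LHS](BK x) AK'.
subst B'; have hfin S s y := @ext_sym_finite h g A B S1 S s y AK BK hK hA gB' S1E h10.
have hE S y : sval_set (h S) y = sval_set S (B y).
  have [_ [_ [_ _ hc _]] _] := hA.
  have [W WP] := continuous_window S y hc.
  (* Membership of [y] in h(S) depends only on [S] within [W], so [S] may be replaced by a finite
     subset; including [B y] keeps the value on the right unchanged. *)
  pose s := [seq x <- B y :: W | sval_set S x].
  have sa : admissible k (fun x => x \in s).
    apply: admissibleW (sval_set_admissible S) => x.
    by rewrite mem_filter => /andP[].
  rewrite -(WP (admissible_point sa)) => [|w wW].
    rewrite (hfin _ s) // -{1}(BK y) mem_map; last exact: can_inj AK.
    by rewrite mem_filter mem_head andbT.
  by rewrite {1}/sval_set /= mem_filter inE wW orbT andbT.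
exists t; split=> [S y|s sa].
  by rewrite -hE /h /comp sval_translate opprK subrK.
have := sval_set_admissible (g (admissible_point sa)).
apply: admissibleW => x xs; rewrite -(AK x) -hE gK /sval_set /=.
exact: map_f.
Qed.
End FiniteSets.

(** * Affine symmetries *)

Lemma ideal_exp_rmorph (R S : comNzRingType) (f : {rmorphism R -> S})
    (p : idealr R) (q : idealr S) n x :
  (forall u, u \in p -> f u \in q) -> idl_exp p n x -> idl_exp q n (f x).
Proof.
move=> pq; elim: n x => [//|n IH] x [s sp ->]; rewrite rmorph_sum.
apply: ideal_exp_sum_seq => u /sp[up un].
by rewrite rmorphM; apply: ideal_expSM; [exact: pq|exact: IH].
Qed.

Section Affine.
Variables (K : fieldExtType rat) (k : nat).
Local Notation OK := (ring_of_integers K).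
Local Notation D := (admissible_system K k).

Lemma oautK (tau : ring_aut K) : cancel (oaut tau) (oaut tau^-1%g).
Proof. by move=> x; rewrite -oautM mulVg oaut1. Qed.

Lemma oautVK (tau : ring_aut K) : cancel (oaut tau^-1%g) (oaut tau).
Proof. by move=> x; rewrite -oautM mulgV oaut1. Qed.

(** If [S] misses the class of a modulo the k-th power of the preimage of [p] under tau, its image
    misses the class of t + eps tau(a) modulo p^k. *)
Lemma affine_admissible (tau : ring_aut K) (eps : runit OK) (t : OK) S :
  admissible k S ->
  admissible k (subset_image (fun x => t + runit_val eps * oaut tau x) S).
Proof.
move=> Sa p [w wp w0].
pose T : {pred OK} := fun x => oaut tau x \in p.
have inT x : (x \in T) = (oaut tau x \in p) by [].
have [||q qE] := @prime_idealr_ex OK T.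
- split; rewrite ?inT ?rmorph0 ?rpred0 ?rmorph1 ?idealr1 // => a u v.
  by rewrite !inT rmorphD rmorphM => up vp; rewrite rpredD ?idealMr.
- by move=> u v; rewrite !inT rmorphM prime_idealrM.
have [|a aP] := Sa q.
  exists (oaut tau^-1%g w); first by rewrite qE /T oautVK.
  by rewrite -(rmorph0 (oaut tau^-1%g)) (can_eq (oautVK tau)).
exists (t + runit_val eps * oaut tau a) => y /asboolP[x Sx <-].
rewrite opprD addrACA subrr add0r -mulrBr -rmorphB.
move=> /(ideal_expMl (runit_val eps)^-1); rewrite mulKr ?runitP //.
move=> /(@ideal_exp_rmorph _ _ (oaut tau^-1%g) p q k) xa.
by apply: (aP x Sx); rewrite -(oautK tau (x - a)); apply: xa => u up; rewrite qE /T oautVK.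
Qed.

Definition affine_image (tau : ring_aut K) (eps : runit OK) (t : OK) (S : D) : D :=
  admissible_point (affine_admissible tau eps t (sval_set_admissible S)).

Lemma pullback_continuous (f : D -> D) (h : OK -> OK) :
  (forall S y, sval_set (f S) y = sval_set S (h y)) -> continuous f.
Proof.
move=> fE; apply: continuous_comp_initial => S.
apply/cvg_sup; first exact/fmap_filter/nbhs_filter.
move=> y; move: S.
apply/(@continuousP _ (initial_topology (@^~ y))) => A [B oB <-].
rewrite (_ : _ @^-1` _ = (fun S : D => sval_set S (h y)) @^-1` B).
  apply: open_comp oB => S _.
  apply: (@continuous_comp D {ptws OK -> bool} bool set_val (fun f => f (h y))).
    exact: initial_continuous.
  exact: (@proj_continuous OK (fun=> bool) (h y)).
by apply/funext => S; rewrite /= -fE.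
Qed.

Section AffineSymmetry.
Variables (tau : ring_aut K) (eps : runit OK) (t : OK).

Let h x : OK := t + runit_val eps * oaut tau x.
Let B x : OK := oaut tau^-1%g ((runit_val eps)^-1 * x).

Lemma semilinear_invK : cancel (fun x => runit_val eps * oaut tau x) B.
Proof. by move=> x; rewrite /B mulKr ?runitP // oautK. Qed.

Lemma semilinear_invVK : cancel B (fun x => runit_val eps * oaut tau x).
Proof. by move=> x; rewrite /B oautVK mulVKr ?runitP. Qed.

Lemma affine_imageE (S : {ptws OK -> bool}) y : subset_image h S y = S (B (y - t)).
Proof.
apply: (@subset_image_can _ _ (fun y => B (y - t))) => x.
  by rewrite /h addrC addKr semilinear_invK.
by rewrite /h semilinear_invVK addrC subrK.
Qed.

Lemma affine_extended_symmetry (f : D -> D) (A : OK -> OK) :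
  (forall x, A x = runit_val eps * oaut tau x) ->
  (forall S : D, \val (f S) = subset_image h (\val S)) ->
  extended_symmetry f A.
Proof.
move=> AE fE.
have AK : cancel A B by move=> x; rewrite AE semilinear_invK.
have BK : cancel B A by move=> x; rewrite AE semilinear_invVK.
have Aadd : zmod_morphism A by move=> x y; rewrite !AE rmorphB mulrBr.
have f_pull S y : sval_set (f S) y = sval_set S (B (y - t)).
  by rewrite /sval_set fE affine_imageE.
(* The inverse is again affine, with automorphism tau^-1, unit tau^-1(eps^-1) and translation -
   B(t). *)
pose eps' : runit OK := oaut_unit tau^-1%g (eps^-1)%g.
have BE x : B x = runit_val eps' * oaut tau^-1%g x by rewrite /B rmorphM.
pose g := affine_image tau^-1%g eps' (- B t).
have hh : cancel (fun x => - B t + runit_val eps' * oaut tau^-1%g x) (fun x => t + A x).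
  move=> x; rewrite -BE (additiveD Aadd) (additiveN Aadd) !BK; ring.
have hh' : cancel (fun x => t + A x) (fun x => - B t + runit_val eps' * oaut tau^-1%g x).
  move=> x; rewrite -BE addrC -(additiveB (zmod_morphism_inv Aadd AK BK)).
  by rewrite addrC addKr AK.
have g_pull S y : sval_set (g S) y = sval_set S (t + A y).
  exact: (subset_image_can (\val S) y hh hh').
split.
- by split=> //; exists B.
- exists g; split.
  + by move=> S; apply: sval_set_inj => x; rewrite g_pull f_pull addrC addKr AK.
  + by move=> S; apply: sval_set_inj => x; rewrite f_pull g_pull BK addrC subrK.
  + exact: pullback_continuous f_pull.
  + exact: pullback_continuous g_pull.
- move=> a S; apply: sval_set_inj => y.
  rewrite sval_translate !f_pull sval_translate; congr (sval_set S _).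
  rewrite -{1}(AK a) -(additiveB (zmod_morphism_inv Aadd AK BK)); congr B; ring.
Qed.
End AffineSymmetry.
End Affine.

(** * From the multiplicative identity to a field automorphism *)

Section Multiplicative.
Variables (K : fieldExtType rat).
Local Notation OK := (ring_of_integers K).
Variables A B : OK -> OK.
Hypothesis Aadd : zmod_morphism A.
Hypotheses (AK : cancel A B) (BK : cancel B A).
Hypothesis A_mul : forall x y, A x * A y = A 1 * A (x * y).

(** A / A(1) extends to fractions by u / n -> A(u) / (n A(1)), independently of the fraction since
    [A] is additive, and the identity [A_mul] makes it a ring morphism. Surjectivity of [A] makes
    A(1) a unit. *)
Lemma additive_mul_semilinear : exists (tau : ring_aut K) (eps : runit OK),
  forall x, A x = runit_val eps * oaut tau x.
Proof.
pose a1 : K := oval (A 1).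
have oval_mul (x y : OK) : oval (x * y) = oval x * oval y by [].
have oval_sub (x y : OK) : oval (x - y) = oval x - oval y by [].
have oval_int (n : int) : oval n%:~R = n%:~R by rewrite rmorph_int.
have oval_inj : injective (@oval K) := val_inj.
have A_eq0 x : A x = 0 -> x = 0.
  by move=> Ax; apply: (can_inj AK); rewrite Ax (additive0 Aadd).
have a10 : a1 != 0.
  apply/eqP => a1E; have /A_eq0/eqP : A 1 = 0 by apply: val_inj.
  by rewrite oner_eq0.
have /choice[nu nuP] (z : K) : exists nu : int * OK,
    nu.1 != 0 /\ oval nu.2 = nu.1%:~R * z.
  by have [n n0 nz] := integer_multiple z; exists (n, RingOfIntegers nz).
pose T (z : K) : K := oval (A (nu z).2) / ((nu z).1%:~R * a1).
have TP z (n : int) u : n != 0 -> oval u = n%:~R * z ->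
    T z = oval (A u) / (n%:~R * a1).
  move=> n0 uE; have [m0 vE] := nuP z; rewrite /T.
  move: (nu z) m0 vE => [m v] /= m0 vE.
  have nv : n%:~R * v = m%:~R * u.
    by apply: oval_inj; rewrite !oval_mul !oval_int uE vE mulrCA.
  have := congr1 (fun x => oval (A x)) nv.
  rewrite !(additiveMint Aadd) !oval_mul !oval_int => e.
  have nK : (n%:~R : K) != 0 by rewrite intK_eq0.
  have mK : (m%:~R : K) != 0 by rewrite intK_eq0.
  apply/eqP; rewrite eqr_div ?mulf_neq0 //; apply/eqP.
  transitivity ((n%:~R * oval (A v)) * a1); first by ring.
  by rewrite e; ring.
have TO x : T (oval x) = oval (A x) / a1.
  by rewrite (@TP _ 1 x) // ?mul1r.
have T_sub : zmod_morphism T.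
  move=> x y; have [m0 uE] := nuP x; have [n0 vE] := nuP y.
  move: (nu x) (nu y) m0 n0 uE vE => [m u] [n v] /= m0 n0 uE vE.
  have nK : (n%:~R : K) != 0 by rewrite intK_eq0.
  have mK : (m%:~R : K) != 0 by rewrite intK_eq0.
  rewrite (TP x m u) // (TP y n v) // (@TP _ (m * n) (n%:~R * u - m%:~R * v)).
  - rewrite (additiveB Aadd) !(additiveMint Aadd) oval_sub !oval_mul !oval_int intrM.
    by field; rewrite a10 nK mK.
  - by rewrite mulf_neq0.
  - by rewrite oval_sub !oval_mul !oval_int uE vE intrM; ring.
have T_mul : monoid_morphism T.
  split=> [|x y]; first by rewrite -[1]/(oval 1) TO divff.
  have [m0 uE] := nuP x; have [n0 vE] := nuP y.
  move: (nu x) (nu y) m0 n0 uE vE => [m u] [n v] /= m0 n0 uE vE.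
  have nK : (n%:~R : K) != 0 by rewrite intK_eq0.
  have mK : (m%:~R : K) != 0 by rewrite intK_eq0.
  rewrite (TP x m u) // (TP y n v) // (@TP _ (m * n) (u * v)).
  - have := congr1 (@oval K) (A_mul u v); rewrite !oval_mul -/a1 => e.
    rewrite intrM; apply/eqP; rewrite mulf_div eqr_div ?mulf_neq0 //; apply/eqP.
    by rewrite e; ring.
  - by rewrite mulf_neq0.
  - by rewrite oval_mul uE vE intrM; ring.
have T_inj : injective T.
  move=> x y /eqP; rewrite -subr_eq0 -T_sub /T; have [m0 uE] := nuP (x - y).
  rewrite mulf_eq0 invr_eq0 mulf_eq0 (negPf a10) intK_eq0 (negPf m0) !orbF.
  move=> /eqP Au; have u0 : (nu (x - y)).2 = 0 by apply: A_eq0; exact: oval_inj.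
  move: uE; rewrite u0 => /esym/eqP; rewrite mulf_eq0 intK_eq0 (negPf m0) subr_eq0.
  by move/eqP.
have /choice[Tinv TK] w : exists z, T z = w.
  have [n n0 nw] := integer_multiple (a1 * w); pose v : OK := RingOfIntegers nw.
  have nK : (n%:~R : K) != 0 by rewrite intK_eq0.
  (* [A] sends [B v] to [v], which is n A(1) w. *)
  exists (oval (B v) / n%:~R); rewrite (@TP _ n (B v)) //; last by field.
  by rewrite BK /=; field; rewrite nK a10.
have T_bij : bijective T by exists Tinv => // x; apply: T_inj; rewrite TK.
have T_aut : Bijection T_bij \in @is_ring_aut K by apply/asboolP.
pose tau : ring_aut K := RingAut T_aut.
have AE x : A x = A 1 * oaut tau x.
  by apply: oval_inj; rewrite oval_mul /= TO mulrC divfK.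
have A1u : A 1 \is a GRing.unit by apply/unitrPr; exists (oaut tau (B 1)); rewrite -AE BK.
by exists tau, (RUnit A1u).
Qed.
End Multiplicative.

Lemma isomorphic_groups_sym (G H : groupType) :
  isomorphic_groups G H -> isomorphic_groups H G.
Proof.
case=> phi [psi phiK psiK] phiM; exists psi; first by exists phi.
by move=> x y; apply: (can_inj phiK); rewrite phiM !psiK.
Qed.

(** * Classification and the semidirect product *)

Section Main.
Variables (K : fieldExtType rat) (k : nat).
Local Notation OK := (ring_of_integers K).
Local Notation D := (admissible_system K k).
Hypothesis k_gt0 : (0 < k)%N.

Lemma extended_symmetry_affine (f : D -> D) (A : OK -> OK) :
  extended_symmetry f A -> exists (tau : ring_aut K) (eps : runit OK),
    (forall x, A x = runit_val eps * oaut tau x) /\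
    exists t : OK, forall S : D,
      \val (f S) = subset_image (fun x => t + runit_val eps * oaut tau x) (\val S).
Proof.
move=> fA; have [[Aadd [B AK BK]] _ _] := fA.
have [t [fE A_adm]] := ext_sym_shape k_gt0 fA AK BK.
have [tau [eps AE]] := additive_mul_semilinear Aadd AK BK (additive_mul k_gt0 Aadd A_adm).
exists tau, eps; split=> //; exists t => S; apply/funext => y.
rewrite -[LHS]/(sval_set (f S) y) fE affine_imageE /sval_set; congr (\val S _).
by apply: (can_inj AK); rewrite BK AE semilinear_invVK.
Qed.

Lemma subset_image_comp (h h' : OK -> OK) (S : {ptws OK -> bool}) :
  subset_image h (subset_image h' S) = subset_image (h \o h') S.
Proof.
apply/funext => y; apply/asboolP/asboolP.
  by case=> x /asboolP[z Sz <-] <-; exists z.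
by case=> z Sz <-; exists (h' z) => //; apply/asboolP; exists z.
Qed.

Lemma ring_aut_oaut_inj (s t : ring_aut K) : oaut s =1 oaut t -> s = t.
Proof.
move=> st; apply/val_inj/bijectionP => z /=.
have [n n0 nz] := integer_multiple z.
have := congr1 (@oval K) (st (RingOfIntegers nz)).
rewrite /= !rmorphM !rmorph_int; apply: mulfI; by rewrite intK_eq0.
Qed.

Let affine (x : sdprod (semilinear_action K)) (y : OK) : OK :=
  (x.1 : OK) + Defs.semilinear x.2 y.

Let affineM x y : affine (x * y)%g = affine x \o affine y.
Proof.
apply/funext => z; rewrite /affine /= Defs.semilinearM.
rewrite /Defs.semilinear rmorphD mulrDr addrA; congr (_ + _).
Qed.

(** The isomorphism is built from the semidirect product to the symmetries. The classification gives
    surjectivity; for injectivity, the image of {0} recovers t, the value A(1) recovers eps, and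
    then [A] determines tau. *)
Lemma ext_sym_isomorphic : isomorphic_groups (ext_sym D) (sdprod (semilinear_action K)).
Proof.
apply: isomorphic_groups_sym.
have /choice[psi psiP] (x : sdprod (semilinear_action K)) : exists e : ext_sym D,
    (ext_sym_pair e).2 =1 Defs.semilinear x.2 /\
    forall S : D, \val ((ext_sym_pair e).1 S) = subset_image (affine x) (\val S).
  case: x => t [eps tau].
  pose f := affine_image tau eps t : D -> D.
  have fA : extended_symmetry f (Defs.semilinear (eps, tau)).
    exact: (@affine_extended_symmetry _ _ tau eps t).
  have [[_ A_bij] [g [fK gK _ _]] _] := fA.
  have f_bij : bijective f by exists g.
  have eP : (Bijection f_bij, Bijection A_bij) \in @is_ext_sym _ D by apply/asboolP.
  by exists (ExtSym eP).
have ext_sym_eq (e e' : ext_sym D) :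
    (ext_sym_pair e).1 =1 (ext_sym_pair e').1 -> (ext_sym_pair e).2 =1 (ext_sym_pair e').2 -> e = e'.
  case: e e' => [[e1 e2] eP] [[e1' e2'] eP'] /= e11 e22.
  by apply: val_inj; rewrite /= (bijectionP e11) (bijectionP e22).
have psiM : {morph psi : x y / (x * y)%g}.
  move=> x y; have [x2 x1] := psiP x; have [y2 y1] := psiP y; have [xy2 xy1] := psiP (x * y)%g.
  apply: ext_sym_eq => [S|z] /=.
    by apply: val_inj; rewrite xy1 x1 y1 subset_image_comp affineM.
  by rewrite xy2 x2 y2 -Defs.semilinearM.
exists psi => //.
have psi_inj : injective psi.
  move=> x y xy; have [x2 x1] := psiP x; have [y2 y1] := psiP y.
  have xy2 z : Defs.semilinear x.2 z = Defs.semilinear y.2 z by rewrite -x2 -y2 xy.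
  pose S1 : D := admissible_point (singleton_admissible 0 k_gt0).
  have affine0 u : affine u 0 = u.1 by rewrite /affine /Defs.semilinear rmorph0 mulr0 addr0.
  have psi_S1 u z : sval_set ((ext_sym_pair (psi u)).1 S1) z = (z == u.1).
    have [_ u1] := psiP u; rewrite /sval_set u1.
    apply/asboolP/eqP => [[w /eqP -> <-]|->]; first exact: affine0.
    by exists 0; [exact: eqxx|exact: affine0].
  have xy1 : x.1 = y.1 by apply/eqP; rewrite -(psi_S1 y) -xy psi_S1.
  have eps_eq : x.2.1 = y.2.1.
    apply: val_inj; have := xy2 1.
    by rewrite /Defs.semilinear !rmorph1 !mulr1.
  have tau_eq : x.2.2 = y.2.2.
    apply: ring_aut_oaut_inj => z; have := xy2 z; rewrite /Defs.semilinear eps_eq.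
    by apply: mulrI; exact: runitP.
  move: x y xy1 eps_eq tau_eq {x2 x1 y2 y1 xy xy2} => [t [eps tau]] [t' [eps' tau']] /=.
  by move=> -> -> ->.
have /choice[phi phiK] (e : ext_sym D) : exists x, psi x = e.
  have /asboolP eA := ext_symP e.
  have [tau [eps [AE [t fE]]]] := extended_symmetry_affine eA.
  exists (t, (eps, tau)); have [x2 x1] := psiP (t, (eps, tau)).
  apply: ext_sym_eq => [S|z]; first by apply: val_inj; rewrite x1 fE.
  by rewrite x2 AE.
by exists phi => // x; apply: psi_inj; rewrite phiK.
Qed.
End Main.

Theorem theorem1p3 (K : fieldExtType rat) (k : nat) (k_ge2 : (2 <= k)%N) :
  let OK := ring_of_integers K in
  let D := admissible_system K k in
  [/\ (forall (tau : ring_aut K) (eps : runit OK) (t : OK),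
         exists f : D -> D, forall S : D,
           \val (f S) = subset_image (fun x => t + runit_val eps * oaut tau x) (\val S)),
      (forall (f : D -> D) (A : OK -> OK),
         extended_symmetry f A <->
         exists (tau : ring_aut K) (eps : runit OK),
           (forall x, A x = runit_val eps * oaut tau x) /\
           exists t : OK, forall S : D,
             \val (f S) = subset_image (fun x => t + runit_val eps * oaut tau x) (\val S))
    & isomorphic_groups (ext_sym D) (sdprod (semilinear_action K))].
Proof.
have k_gt0 := ltnW k_ge2; split.
- by move=> tau eps t; exists (affine_image tau eps t).
- move=> f A; split; first exact: extended_symmetry_affine.
  by case=> tau [eps [AE [t fE]]]; exact: affine_extended_symmetry AE fE.
- exact: ext_sym_isomorphic.
Qed.
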